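(* Let $q\ge 2$ be an integer, let $T$ be the infinite $q$-ary tree rooted at $r$, and let $\varphi$ be the Gaussian kernel on $\mathbb{S}^1$ with parameter $\beta>0$ described in the context. If $q\,\lambda(\varphi)<1$, then the model has zero information flow, i.e. $\lim_{k\to\infty}\mathbb E[\mathrm{TV}(\mu_k,\sigma)]=0$.
   Context: Identify $\mathbb{S}^1$ with $[0,2\pi)$, let $\sigma$ be the uniform probability measure on it, and let $X\sim\mathcal N(0,\beta)$. The kernel $\varphi:\mathbb{S}^1\times\mathbb{S}^1\to\mathbb R$ is defined by: $\varphi(x,\cdot)$ is the density (with respect to $\sigma$) of $(x+X)\bmod 2\pi$. Define $\lambda(\varphi)=\int_{\mathbb{S}^1}\langle x,e_1\rangle\varphi(e_1,x)\,d\sigma(x)$, viewing points of $\mathbb{S}^1$ as unit vectors in $\mathbb R^2$. Labels on the tree: $g(r)$ is uniform on $\mathbb{S}^1$; iteratively, given the labels of all nodes at level $\ell$, the labels of the nodes at level $\ell+1$ are chosen independently, a child $u$ of $v$ having law $\varphi(g(v),\cdot)\,d\sigma$. $T_k$ is the set of nodes at depth $k$, and $\mu_k$ is the conditional distribution of $g(r)$ given $(g(v))_{v\in T_k}$. Zero information flow means $\lim_{k\to\infty}\mathbb E[\mathrm{TV}(\mu_k,\sigma)]=0$; positive information flow means this limit is positive. *)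

(* Defs.v *)
From Stdlib Require Import Reals Lra List.
From Coquelicot Require Import Coquelicot.
Open Scope R_scope.

(** The circle S^1 is identified with [0, 2*PI); sigma is the uniform
    probability measure, i.e. (1/(2 PI)) * Lebesgue on [0, 2 PI]. *)

Definition int1 (F : R -> R) : R := RInt F 0 (2 * PI) / (2 * PI).

Fixpoint intS (n : nat) (F : list R -> R) : R :=
  match n with
  | O => F nil
  | S n' => int1 (fun t => intS n' (fun ys => F (t :: ys)))
  end.

Definition prodR (n : nat) (f : nat -> R) : R :=
  fold_right Rmult 1 (map f (seq 0 n)).

Definition gauss (beta t : R) : R :=
  exp (- t ^ 2 / (2 * beta)) / sqrt (2 * PI * beta).

(** phi(x, .) = density w.r.t. sigma of (x + X) mod 2 PI, X ~ N(0,beta):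
    2 PI * sum_{m in Z} gauss(y - x + 2 PI m). *)
Definition phi (beta x y : R) : R :=
  2 * PI *
  (Series (fun m : nat => gauss beta (y - x + 2 * PI * INR m))
   + Series (fun m : nat => gauss beta (y - x - 2 * PI * INR (S m)))).

(** lambda(phi) = int <x, e_1> phi(e_1, x) dsigma(x); e_1 is the angle 0
    and <x, e_1> = cos x. *)
Definition lambda (beta : R) : R := int1 (fun x => cos x * phi beta 0 x).

(** Nodes of T_k (depth k of the q-ary tree) are numbered 0 .. q^k - 1,
    the parent of node j of T_{k+1} being node (j / q) of T_k.
    [dens q beta k x y] = joint density, w.r.t. sigma (x) sigma^{q^(k+1)},
    of (g(r), (g(v))_{v in T_(k+1)}) at root label x and labels y. *)
Fixpoint dens (q : nat) (beta : R) (k : nat) (x : R) (y : list R) : R :=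
  match k with
  | O => prodR q (fun j => phi beta x (nth j y 0))
  | S k' =>
      intS (q ^ (S k'))
        (fun z => dens q beta k' x z *
                  prodR (q ^ (S k)) (fun j => phi beta (nth (j / q) z 0) (nth j y 0)))
  end.

Definition marg (q : nat) (beta : R) (k : nat) (y : list R) : R :=
  int1 (fun x => dens q beta k x y).

(** Density w.r.t. sigma of mu_(k+1) (conditional law of g(r) given the
    labels y of T_(k+1)), by Bayes' formula (the root is sigma-uniform). *)
Definition cond_dens (q : nat) (beta : R) (k : nat) (y : list R) (x : R) : R :=
  dens q beta k x y / marg q beta k y.

Definition tv_unif (f : R -> R) : R := / 2 * int1 (fun x => Rabs (f x - 1)).

(** E[TV(mu_k, sigma)] for depth k.  For k = 0, mu_0 is the Dirac mass at
    g(r), whose TV distance to sigma is 1. *)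
Definition exp_tv (q : nat) (beta : R) (k : nat) : R :=
  match k with
  | O => 1
  | S k' => intS (q ^ k) (fun y => marg q beta k' y * tv_unif (cond_dens q beta k' y))
  end.

(* Main.v *)
(** On the circle with the chord distance [|sin ((x - y) / 2)|], one step of the Gaussian kernel
    multiplies Lipschitz constants by [lambda]. Indeed, fold the circle by the reflection exchanging
    two given points: the difference of the two transition densities is odd, nonnegative on one
    half (it is the heat kernel with Dirichlet conditions on a half circle) and [sin] is an
    eigenfunction for the eigenvalue [lambda]. On a level of the tree take the sum of the chord
    distances over the vertices. Averaging over the [q] children of every vertex multiplies the
    Lipschitz constant of a function of the labels by [q lambda], and the lowest step already turns
    functions bounded by [1] into functions with a constant proportional to the number of children.
    Hence, for [|f| <= 1], the conditional expectation of [f] (labels at depth [k]) given the root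
    oscillates by at most [C q (q lambda)^(k-1)], and by duality this bounds the expected total
    variation. *)

Require Import Defs.
From Stdlib Require Import Reals Lra Lia List FunctionalExtensionality Arith ZArith
  IndefiniteDescription.
From Coquelicot Require Import Coquelicot.
Open Scope R_scope.

(** * Bounded Lipschitz functions and iterated integrals *)

(** All integrals are Riemann integrals, so integrability and exchange of order have to be secured
    for every integrand. One class does this: functions that are bounded and Lipschitz for the l1
    distance on the labels. It is stable under products, absolute values and integration of some of
    the variables, and Fubini is elementary on it. The rate is exactly [lambda] because the points
    at angles [u] and [-u] from the axis of the reflection have chord [sin u]: the distance to be
    contracted is itself the eigenfunction on the half circle. The sign of the folded kernel is the
    analytic core. It comes from a minimum principle for the heat equation, with [beta] as time,
    applied to finite sums of Gaussians so that no series has to be differentiated; truncating costs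
    only a boundary term of favourable sign. The Gaussian integral enters through the normalisation
    of [phi]. *)

Definition cts (f : R -> R) := forall x, continuous f x.

Lemma cts_lip (f : R -> R) (M : R) :
  (forall x y, Rabs (f x - f y) <= M * Rabs (x - y)) -> cts f.
Proof.
  intros H x. apply continuity_pt_filterlim. intros e He.
  assert (HM : 0 < Rabs M + 1) by (pose proof (Rabs_pos M); lra).
  exists (e / (Rabs M + 1)). split; [now apply Rdiv_lt_0_compat|].
  intros y [_ Hy]. simpl in *. unfold R_dist in *.
  apply Rle_lt_trans with (1 := H y x).
  apply Rle_lt_trans with ((Rabs M + 1) * Rabs (y - x)).
  - apply Rmult_le_compat_r; [apply Rabs_pos|]. pose proof (Rle_abs M). lra.
  - apply (Rmult_lt_compat_l (Rabs M + 1)) in Hy; [|lra].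
    replace ((Rabs M + 1) * (e / (Rabs M + 1))) with e in Hy by (field; lra). exact Hy.
Qed.

Lemma cts_ex_RInt (f : R -> R) a b : cts f -> ex_RInt f a b.
Proof. intros H. apply (ex_RInt_continuous (V := R_CompleteNormedModule)). intros; apply H. Qed.

Lemma two_PI_pos : 0 < 2 * PI.
Proof. pose proof PI_RGT_0; lra. Qed.

Lemma int1_lin (f g : R -> R) a b : cts f -> cts g ->
  int1 (fun t => a * f t + b * g t) = a * int1 f + b * int1 g.
Proof.
  intros Hf Hg. unfold int1. pose proof two_PI_pos.
  rewrite (RInt_plus (V := R_CompleteNormedModule) (fun t => a * f t) (fun t => b * g t)).
  - rewrite (RInt_scal (V := R_CompleteNormedModule) f), (RInt_scal (V := R_CompleteNormedModule) g)
      by now apply cts_ex_RInt.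
    unfold scal, plus; simpl; unfold mult; simpl. field. lra.
  - apply (ex_RInt_scal (V := R_NormedModule) f). now apply cts_ex_RInt.
  - apply (ex_RInt_scal (V := R_NormedModule) g). now apply cts_ex_RInt.
Qed.

Lemma int1_const c : int1 (fun _ => c) = c.
Proof.
  unfold int1. pose proof two_PI_pos. rewrite RInt_const.
  unfold scal; simpl; unfold mult; simpl. field. lra.
Qed.

Lemma int1_le (f g : R -> R) : cts f -> cts g ->
  (forall t, 0 <= t <= 2 * PI -> f t <= g t) -> int1 f <= int1 g.
Proof.
  intros Hf Hg H. unfold int1. pose proof two_PI_pos.
  apply Rmult_le_compat_r; [apply Rlt_le, Rinv_0_lt_compat; lra|].
  apply RInt_le; [lra|now apply cts_ex_RInt|now apply cts_ex_RInt|].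
  intros; apply H; lra.
Qed.

Lemma cts_abs f : cts f -> cts (fun t => Rabs (f t)).
Proof. intros H x. apply (continuous_comp f Rabs); [apply H|apply continuous_Rabs]. Qed.
Lemma cts_const c : cts (fun _ => c).
Proof. intros x. apply continuous_const. Qed.
Lemma cts_plus f g : cts f -> cts g -> cts (fun t => f t + g t).
Proof. intros Hf Hg x. apply (continuous_plus f g); auto. Qed.
Lemma cts_minus f g : cts f -> cts g -> cts (fun t => f t - g t).
Proof. intros Hf Hg x. apply (continuous_minus f g); auto. Qed.
Lemma cts_mult f g : cts f -> cts g -> cts (fun t => f t * g t).
Proof. intros Hf Hg x. apply (continuous_mult f g); auto. Qed.
Lemma cts_id : cts (fun t => t).
Proof. intros x. apply continuous_id. Qed.
Lemma cts_comp f g : cts f -> cts g -> cts (fun t => f (g t)).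
Proof. intros Hf Hg x. apply (continuous_comp g f); auto. Qed.

Lemma int1_minus (f g : R -> R) : cts f -> cts g ->
  int1 (fun t => f t - g t) = int1 f - int1 g.
Proof.
  intros Hf Hg. replace (fun t => f t - g t) with (fun t => 1 * f t + (-1) * g t)
    by (apply functional_extensionality; intros; ring).
  rewrite int1_lin by assumption. ring.
Qed.

Lemma int1_scal (f : R -> R) a : cts f -> int1 (fun t => a * f t) = a * int1 f.
Proof.
  intros Hf. replace (fun t => a * f t) with (fun t => a * f t + 0 * f t)
    by (apply functional_extensionality; intros; ring).
  rewrite int1_lin by assumption. ring.
Qed.

Lemma int1_abs_le (f g : R -> R) : cts f -> cts g ->
  (forall t, 0 <= t <= 2 * PI -> Rabs (f t) <= g t) -> Rabs (int1 f) <= int1 g.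
Proof.
  intros Hf Hg H. apply Rabs_le. split.
  - replace (- int1 g) with (int1 (fun t => (-1) * g t)) by (rewrite int1_scal by easy; ring).
    apply int1_le; [apply cts_mult; [apply cts_const|easy]|easy|].
    intros t Ht. specialize (H t Ht). apply Rabs_le_between in H. lra.
  - apply int1_le; [easy|easy|]. intros t Ht. specialize (H t Ht). apply Rabs_le_between in H. lra.
Qed.

(** Boundedness is included because products of Lipschitz functions are Lipschitz only when the
    factors are bounded. [d] need not be a metric: on lists it will not see the entries past a given
    length. *)
Definition bounded_lip {X : Type} (d : X -> X -> R) (F : X -> R) : Prop :=
  exists M, 0 <= M /\ (forall a, Rabs (F a) <= M)
            /\ forall a b, Rabs (F a - F b) <= M * d a b.

Definition nonneg_dist {X : Type} (d : X -> X -> R) := forall a b, 0 <= d a b.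

Definition dR (a b : R) := Rabs (a - b).

Definition prod_dist {X Y : Type} (d : X -> X -> R) (d' : Y -> Y -> R) (p p' : X * Y) : R :=
  d (fst p) (fst p') + d' (snd p) (snd p').

(** Joint regularity: this is the form that survives integration in one of the two variables. *)
Definition bounded_lip2 {X Y : Type} (d : X -> X -> R) (d' : Y -> Y -> R) (F : X -> Y -> R) : Prop :=
  bounded_lip (prod_dist d d') (fun p => F (fst p) (snd p)).

Lemma nneg_dR : nonneg_dist dR.
Proof. intros a b. apply Rabs_pos. Qed.

Lemma nneg_dp {X Y} (d : X -> X -> R) (d' : Y -> Y -> R) : nonneg_dist d -> nonneg_dist d' ->
  nonneg_dist (prod_dist d d').
Proof. intros H H' a b. unfold prod_dist. specialize (H (fst a) (fst b)).
specialize (H' (snd a) (snd b)). lra. Qed.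

Lemma bounded_lip_const {X} (d : X -> X -> R) c : nonneg_dist d -> bounded_lip d (fun _ => c).
Proof.
  intros Hd. exists (Rabs c). split; [apply Rabs_pos|]. split; [intros; lra|].
  intros a b. rewrite Rminus_diag, Rabs_R0. apply Rmult_le_pos; [apply Rabs_pos|apply Hd].
Qed.

Lemma bounded_lip_plus {X} (d : X -> X -> R) F G : bounded_lip d F -> bounded_lip d G ->
  bounded_lip d (fun x => F x + G x).
Proof.
  intros (M & HM & H1 & H2) (N & HN & H3 & H4). exists (M + N). split; [lra|]. split.
  - intros a. apply Rle_trans with (1 := Rabs_triang _ _). specialize (H1 a). specialize (H3 a). lra.
  - intros a b. replace (F a + G a - (F b + G b)) with ((F a - F b) + (G a - G b)) by ring.
    apply Rle_trans with (1 := Rabs_triang _ _). specialize (H2 a b). specialize (H4 a b). lra.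
Qed.

Lemma bounded_lip_mult {X} (d : X -> X -> R) F G : nonneg_dist d -> bounded_lip d F ->
  bounded_lip d G -> bounded_lip d (fun x => F x * G x).
Proof.
  intros Hd (M & HM & H1 & H2) (N & HN & H3 & H4).
  assert (0 <= M * N) by now apply Rmult_le_pos.
  exists (2 * (M * N)). split; [lra|]. split.
  - intros a. rewrite Rabs_mult.
    apply Rle_trans with (M * N); [|lra]. apply Rmult_le_compat; auto using Rabs_pos.
  - intros a b. replace (F a * G a - F b * G b) with ((F a - F b) * G a + F b * (G a - G b)) by ring.
    apply Rle_trans with (1 := Rabs_triang _ _). rewrite !Rabs_mult.
    assert (Rabs (F a - F b) * Rabs (G a) <= (M * d a b) * N)
      by (apply Rmult_le_compat; auto using Rabs_pos).
    assert (Rabs (F b) * Rabs (G a - G b) <= M * (N * d a b))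
      by (apply Rmult_le_compat; auto using Rabs_pos).
    lra.
Qed.

Lemma bounded_lip_scal {X} (d : X -> X -> R) c F : nonneg_dist d -> bounded_lip d F ->
  bounded_lip d (fun x => c * F x).
Proof. intros. apply bounded_lip_mult; auto using bounded_lip_const. Qed.

Lemma bounded_lip_minus {X} (d : X -> X -> R) F G : nonneg_dist d -> bounded_lip d F ->
  bounded_lip d G -> bounded_lip d (fun x => F x - G x).
Proof.
  intros Hd H1 H2. replace (fun x => F x - G x) with (fun x => F x + (-1) * G x)
    by (apply functional_extensionality; intros; ring).
  auto using bounded_lip_plus, bounded_lip_scal.
Qed.

Lemma bounded_lip_abs {X} (d : X -> X -> R) F : bounded_lip d F -> bounded_lip d (fun x => Rabs (F x)).
Proof.
  intros (M & HM & H1 & H2). exists M. split; [easy|]. split.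
  - intros a. now rewrite Rabs_Rabsolu.
  - intros a b. apply Rle_trans with (2 := H2 a b). apply Rabs_triang_inv2.
Qed.

Lemma bounded_lip_comp {X Y} (d : X -> X -> R) (d' : Y -> Y -> R) (K : R) (m : Y -> X) F :
  nonneg_dist d' -> (forall a b, d (m a) (m b) <= K * d' a b) -> bounded_lip d F ->
    bounded_lip d' (fun y => F (m y)).
Proof.
  intros Hd' Hm (M & HM & H1 & H2).
  assert (0 <= M * Rabs K) by (apply Rmult_le_pos; auto using Rabs_pos).
  exists (M + M * Rabs K). split; [lra|]. split.
  - intros a. specialize (H1 (m a)). lra.
  - intros a b. apply Rle_trans with (1 := H2 _ _).
    apply Rle_trans with (M * (K * d' a b)); [now apply Rmult_le_compat_l|].
    pose proof (Hd' a b) as Hab. pose proof (Rle_abs K).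
    assert (K * d' a b <= Rabs K * d' a b) by now apply Rmult_le_compat_r.
    assert (M * (K * d' a b) <= M * (Rabs K * d' a b)) by now apply Rmult_le_compat_l.
    assert (0 <= M * d' a b) by now apply Rmult_le_pos. lra.
Qed.

Lemma bounded_lip_cts F : bounded_lip dR F -> cts F.
Proof. intros (M & _ & _ & H). now apply cts_lip with M. Qed.

Lemma bounded_lip2_l {X Y} (d : X -> X -> R) (d' : Y -> Y -> R) F y :
  nonneg_dist d -> d' y y = 0 -> bounded_lip2 d d' F -> bounded_lip d (fun x => F x y).
Proof.
  intros Hd Hy H. apply (bounded_lip_comp (prod_dist d d') d 1 (fun x => (x,
    y)) (fun p => F (fst p) (snd p))); trivial.
  intros a b. unfold prod_dist. simpl. lra.
Qed.

Lemma bounded_lip2_r {X Y} (d : X -> X -> R) (d' : Y -> Y -> R) F x :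
  nonneg_dist d' -> d x x = 0 -> bounded_lip2 d d' F -> bounded_lip d' (F x).
Proof.
  intros Hd Hy H. apply (bounded_lip_comp (prod_dist d d') d' 1 (fun y => (x,
    y)) (fun p => F (fst p) (snd p))); trivial.
  intros a b. unfold prod_dist. simpl. lra.
Qed.

Lemma dR_refl a : dR a a = 0.
Proof. unfold dR. rewrite Rminus_diag. apply Rabs_R0. Qed.

Lemma bounded_lip2_sym {X Y} (d : X -> X -> R) (d' : Y -> Y -> R) F :
  nonneg_dist d -> nonneg_dist d' -> bounded_lip2 d d' F -> bounded_lip2 d' d (fun y x => F x y).
Proof.
  intros Hd Hd' H.
  apply (bounded_lip_comp (prod_dist d d') (prod_dist d' d) 1 (fun p => (snd p,
    fst p)) (fun p => F (fst p) (snd p))); trivial.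
  - now apply nneg_dp.
  - intros a b. unfold prod_dist. simpl. lra.
Qed.

Lemma bounded_lip2_int1 {X} (d : X -> X -> R) (F : X -> R -> R) :
  (forall x, d x x = 0) -> nonneg_dist d -> bounded_lip2 d dR F -> bounded_lip d (fun x => int1 (F x)).
Proof.
  intros Hr Hd HF.
  assert (Hc : forall x, cts (F x)) by (intros x; apply bounded_lip_cts; eapply bounded_lip2_r;
    eauto using nneg_dR).
  destruct HF as (M & HM & H1 & H2). exists M. split; [easy|]. split.
  - intros a. rewrite <- (int1_const M). apply int1_abs_le; auto using cts_const.
    intros t _. apply (H1 (a, t)).
  - intros a b. rewrite <- int1_minus by auto. rewrite <- (int1_const (M * d a b)).
    apply int1_abs_le; auto using cts_const, cts_minus.
    intros t _. specialize (H2 (a, t) (b, t)). unfold prod_dist in H2. simpl in H2.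
    rewrite dR_refl, Rplus_0_r in H2. exact H2.
Qed.

(** Peels off the first term, as [intS] and [prodR_S] peel off the head of a list, so that
    inductions on levels run in parallel. *)
Fixpoint sumN (n : nat) (f : nat -> R) : R :=
  match n with O => 0 | S m => f O + sumN m (fun j => f (S j)) end.

(** Missing entries read as 0 and entries from position [n] on are ignored. [rho] will be the usual
    distance, a multiple of the chord, or a discrete distance. *)
Definition dsum (rho : R -> R -> R) (n : nat) (y y' : list R) : R :=
  sumN n (fun j => rho (nth j y 0) (nth j y' 0)).

Definition list_dist := dsum dR.

Lemma dl_cons n t t' y y' : list_dist (S n) (t :: y) (t' :: y') = dR t t' + list_dist n y y'.
Proof. reflexivity. Qed.

Lemma sumN_ext n f g : (forall j, (j < n)%nat -> f j = g j) -> sumN n f = sumN n g.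
Proof.
  revert f g. induction n as [|n IH]; intros f g H; simpl; [easy|].
  rewrite (H 0%nat) by lia. rewrite (IH _ (fun j => g (S j))); [easy|]. intros; apply H; lia.
Qed.
Lemma sumN_le n f g : (forall j, (j < n)%nat -> f j <= g j) -> sumN n f <= sumN n g.
Proof.
  revert f g. induction n as [|n IH]; intros f g H; simpl; [lra|].
  pose proof (H 0%nat ltac:(lia)).
  assert (sumN n (fun j => f (S j)) <= sumN n (fun j => g (S j))) by (apply IH; intros; apply H;
    lia). lra.
Qed.
Lemma sumN_const n c : sumN n (fun _ => c) = INR n * c.
Proof. induction n as [|n IH]; simpl sumN; [simpl; ring|]. rewrite IH, S_INR. ring. Qed.
Lemma sumN_scal n c f : sumN n (fun j => c * f j) = c * sumN n f.
Proof. revert f; induction n as [|n IH]; intros f; simpl; [ring|]. rewrite (IH (fun j => f (S j))).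
ring. Qed.
Lemma sumN_pos n f : (forall j, 0 <= f j) -> 0 <= sumN n f.
Proof. revert f; induction n as [|n IH]; intros f H; simpl; [lra|].
  pose proof (H 0%nat). pose proof (IH (fun j => f (S j)) (fun j => H (S j))). lra. Qed.

Lemma nneg_dl n : nonneg_dist (list_dist n).
Proof. intros y y'. apply sumN_pos. intros; apply nneg_dR. Qed.
Lemma dl_refl n y : list_dist n y y = 0.
Proof. unfold list_dist, dsum. rewrite (sumN_ext _ _ (fun _ => 0)). rewrite sumN_const; ring.
intros; apply dR_refl. Qed.

#[local] Hint Resolve nneg_dR nneg_dl nneg_dp dl_refl dR_refl : bl.

Lemma dp_refl {X Y} (d : X -> X -> R) (d' : Y -> Y -> R) :
  (forall x, d x x = 0) -> (forall x, d' x x = 0) -> forall p, prod_dist d d' p p = 0.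
Proof. intros H H' p. unfold prod_dist. rewrite H, H'. ring. Qed.
#[local] Hint Resolve dp_refl : bl.

Lemma bounded_lip2_intS {X} n (d : X -> X -> R) (F : X -> list R -> R) :
  (forall x, d x x = 0) -> nonneg_dist d -> bounded_lip2 d (list_dist n) F ->
    bounded_lip d (fun x => intS n (F x)).
Proof.
  revert X d F. induction n as [|n IH]; intros X d F Hr Hd HF.
  - apply (bounded_lip2_l d (list_dist 0) F); auto with bl.
  - apply (bounded_lip2_int1 d (fun x t => intS n (fun ys => F x (t :: ys)))); trivial.
    (* The outer integration variable joins the parameter; this is why the induction ranges over all
       parameter spaces [X]. *)
    apply (IH (X * R)%type (prod_dist d dR) (fun p ys => F (fst p) (snd p :: ys))); auto with bl.
    apply (bounded_lip_comp (prod_dist d (list_dist (S n))) (prod_dist (prod_dist d dR) (list_dist n)) 1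
             (fun p => (fst (fst p), snd (fst p) :: snd p)) (fun p => F (fst p) (snd p))); auto with bl.
    intros a b. unfold prod_dist. simpl fst; simpl snd. rewrite dl_cons. lra.
Qed.

Lemma bounded_lip_cons n (F : list R -> R) t : bounded_lip (list_dist (S n)) F ->
  bounded_lip (list_dist n) (fun ys => F (t :: ys)).
Proof.
  intros H. apply (bounded_lip_comp (list_dist (S n)) (list_dist n) 1 (cons t) F); auto with bl.
  intros a b. rewrite dl_cons, dR_refl. lra.
Qed.

Lemma bounded_lip_cons2 n (F : list R -> R) : bounded_lip (list_dist (S n)) F ->
  bounded_lip2 dR (list_dist n) (fun t ys => F (t :: ys)).
Proof.
  intros H. apply (bounded_lip_comp (list_dist (S n)) (prod_dist dR (list_dist n)) 1 (fun p => fst p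
    :: snd p) F); auto with bl.
  intros a b. rewrite dl_cons. unfold prod_dist. lra.
Qed.

Lemma bounded_lip_intS_cons n (F : list R -> R) : bounded_lip (list_dist (S n)) F ->
  bounded_lip dR (fun t => intS n (fun ys => F (t :: ys))).
Proof. intros H. apply (bounded_lip2_intS n dR (fun t ys => F (t :: ys))); auto with bl.
now apply bounded_lip_cons2. Qed.

#[local] Hint Resolve bounded_lip_cons bounded_lip_cons2 bounded_lip_intS_cons bounded_lip_cts
  bounded_lip_const bounded_lip_plus bounded_lip_mult bounded_lip_scal bounded_lip_minus
    bounded_lip_abs : bl.

Lemma intS_lin n (F G : list R -> R) a b : bounded_lip (list_dist n) F -> bounded_lip (list_dist n) G ->
  intS n (fun y => a * F y + b * G y) = a * intS n F + b * intS n G.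
Proof.
  revert F G. induction n as [|n IH]; intros F G HF HG; [reflexivity|]. simpl.
  rewrite <- int1_lin by auto with bl. f_equal. apply functional_extensionality. intros t.
  apply (IH (fun ys => F (t :: ys)) (fun ys => G (t :: ys))); auto with bl.
Qed.

Lemma intS_const n c : intS n (fun _ => c) = c.
Proof. induction n as [|n IH]; simpl; [easy|]. rewrite IH. apply int1_const. Qed.

Lemma intS_le n (F G : list R -> R) : bounded_lip (list_dist n) F -> bounded_lip (list_dist n) G ->
  (forall y, F y <= G y) -> intS n F <= intS n G.
Proof.
  revert F G. induction n as [|n IH]; intros F G HF HG H; simpl; [easy|].
  apply int1_le; auto with bl.
Qed.

Lemma intS_scal n (F : list R -> R) a : bounded_lip (list_dist n) F ->
  intS n (fun y => a * F y) = a * intS n F.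
Proof.
  intros H. replace (fun y => a * F y) with (fun y => a * F y + 0 * F y)
    by (apply functional_extensionality; intros; ring).
  rewrite intS_lin by assumption. ring.
Qed.

Lemma intS_minus n (F G : list R -> R) : bounded_lip (list_dist n) F -> bounded_lip (list_dist n) G ->
  intS n (fun y => F y - G y) = intS n F - intS n G.
Proof.
  intros HF HG. replace (fun y => F y - G y) with (fun y => 1 * F y + (-1) * G y)
    by (apply functional_extensionality; intros; ring).
  rewrite intS_lin by assumption. ring.
Qed.

Lemma intS_abs_le n (F G : list R -> R) : bounded_lip (list_dist n) F -> bounded_lip (list_dist n) G ->
  (forall y, Rabs (F y) <= G y) -> Rabs (intS n F) <= intS n G.
Proof.
  intros HF HG H. apply Rabs_le. split.
  - replace (- intS n G) with (intS n (fun y => (-1) * G y)) by (rewrite intS_scal by easy; ring).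
    apply intS_le; auto with bl. intros y. specialize (H y). apply Rabs_le_between in H. lra.
  - apply intS_le; auto with bl. intros y. specialize (H y). apply Rabs_le_between in H. lra.
Qed.

(** * Exchange of the order of integration *)

Lemma quadratic_const (H : R -> R) (C b : R) : 0 <= b ->
  (forall a h, Rabs (H (a + h) - H a) <= C * (h * h)) -> H b = H 0.
Proof.
  intros Hb HC.
  assert (Hd : forall x, is_derive H x 0).
  { intros x. apply is_derive_Reals. intros e He.
    assert (HC' : 0 < Rabs C + 1) by (pose proof (Rabs_pos C); lra).
    assert (Hq : 0 < e / (Rabs C + 1)) by now apply Rdiv_lt_0_compat.
    exists (mkposreal _ Hq). intros h Hh Hlt. simpl in Hlt.
    rewrite Rminus_0_r. unfold Rdiv. rewrite Rabs_mult, Rabs_inv.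
    assert (Hh' : 0 < Rabs h) by now apply Rabs_pos_lt.
    apply (Rmult_lt_reg_r (Rabs h)); [easy|]. rewrite Rmult_assoc, Rinv_l, Rmult_1_r by lra.
    apply Rle_lt_trans with (1 := HC x h).
    apply Rle_lt_trans with ((Rabs C + 1) * Rabs h * Rabs h).
    - rewrite Rmult_assoc, <- Rabs_mult. rewrite (Rabs_right (h * h)) by nra.
      apply Rmult_le_compat_r; [nra|]. pose proof (Rle_abs C); lra.
    - apply Rmult_lt_compat_r; [easy|]. apply (Rmult_lt_compat_l (Rabs C + 1)) in Hlt; [|lra].
      replace ((Rabs C + 1) * (e / (Rabs C + 1))) with e in Hlt by (field; lra). exact Hlt. }
  destruct (MVT_gen H 0 b (fun _ => 0)) as (c & _ & Hc).
  - intros; apply Hd.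
  - intros x _. apply continuity_pt_filterlim. apply (ex_derive_continuous H). eexists; apply Hd.
  - lra.
Qed.

Lemma bounded_lip2_RInt {X} (d : X -> X -> R) (F : X -> R -> R) a b :
  (forall x, d x x = 0) -> nonneg_dist d -> bounded_lip2 d dR F ->
    bounded_lip d (fun x => RInt (F x) a b).
Proof.
  intros Hr Hd HF.
  assert (Hc : forall x, cts (F x)) by (intros x; apply bounded_lip_cts; eapply bounded_lip2_r;
    eauto using nneg_dR).
  assert (Hbd : forall f m, 0 <= m -> cts f -> (forall t, Rabs (f t) <= m) ->
            Rabs (RInt f a b) <= Rabs (b - a) * m).
  { intros f m Hm Hf Hb. destruct (Rle_dec a b).
    - rewrite (Rabs_right (b - a)) by lra.
      apply (abs_RInt_le_const f a b m); [easy|now apply cts_ex_RInt|auto].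
    - rewrite <- (opp_RInt_swap f b a) by now apply cts_ex_RInt.
      unfold opp; simpl. rewrite Rabs_Ropp. rewrite (Rabs_left (b - a)) by lra.
      replace (- (b - a)) with (a - b) by ring.
      apply (abs_RInt_le_const f b a m); [lra|now apply cts_ex_RInt|auto]. }
  destruct HF as (M & HM & H1 & H2). set (K := Rabs (b - a)).
  assert (HK : 0 <= K) by apply Rabs_pos.
  exists (K * M). split; [now apply Rmult_le_pos|]. split.
  - intros x. apply Hbd; auto. intros t. apply (H1 (x, t)).
  - intros x y. rewrite <- (RInt_minus (V := R_CompleteNormedModule)) by now apply cts_ex_RInt.
    rewrite Rmult_assoc. apply (Hbd (fun t => F x t - F y t)).
    + apply Rmult_le_pos; auto.
    + now apply cts_minus.
    + intros t. specialize (H2 (x, t) (y, t)). unfold prod_dist in H2. simpl in H2.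
      rewrite dR_refl, Rplus_0_r in H2. exact H2.
Qed.

(** First-order expansion of the integral in its upper limit. The increment [h] may be negative,
    since [quadratic_const] needs a two-sided derivative. *)
Lemma RInt_dev (f : R -> R) (M a h : R) : 0 <= M -> cts f ->
  (forall t, Rabs (f t - f a) <= M * Rabs (t - a)) ->
  Rabs (RInt f a (a + h) - h * f a) <= M * (h * h).
Proof.
  intros HM Hf H.
  assert (He : h * f a = RInt (fun _ => f a) a (a + h)).
  { rewrite RInt_const. unfold scal; simpl; unfold mult; simpl. ring. }
  rewrite He, <- (RInt_minus (V := R_CompleteNormedModule)) by (apply cts_ex_RInt;
    auto using cts_const).
  unfold minus, plus, opp; simpl.
  assert (Hc : cts (fun t => f t + - f a)) by (apply cts_minus; auto using cts_const).
  assert (0 <= M * Rabs h) by (apply Rmult_le_pos; auto using Rabs_pos).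
  replace (M * (h * h)) with (Rabs h * (M * Rabs h)).
  2:{ replace (Rabs h * (M * Rabs h)) with (M * (Rabs h * Rabs h)) by ring.
      rewrite <- Rabs_mult, Rabs_right by nra. ring. }
  destruct (Rle_dec 0 h) as [Hh|Hh].
  - rewrite (Rabs_right h) at 1 by lra. replace h with (a + h - a) at 2 by ring.
    apply abs_RInt_le_const; [lra|now apply cts_ex_RInt|].
    intros t Ht. apply Rle_trans with (1 := H t). apply Rmult_le_compat_l; [easy|].
    rewrite !Rabs_right; lra.
  - rewrite <- (opp_RInt_swap _ (a + h) a) by now apply cts_ex_RInt.
    unfold opp; simpl. rewrite Rabs_Ropp.
    rewrite (Rabs_left h) at 1 by lra. replace (- h) with (a - (a + h)) by ring.
    apply abs_RInt_le_const; [lra|now apply cts_ex_RInt|].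
    intros t Ht. apply Rle_trans with (1 := H t). apply Rmult_le_compat_l; [easy|].
    rewrite !Rabs_left1; lra.
Qed.

(** Fubini by differentiation in the upper limit of [x]: when it moves from [a] to [a + h], both
    iterated integrals grow by [h * RInt (f a) 0 c] up to a multiple of [h * h]. Their difference
    [H] is therefore constant, and it vanishes at 0. *)
Lemma RInt_swap_bounded_lip (f : R -> R -> R) (b c : R) : 0 <= b -> 0 <= c -> bounded_lip2 dR dR f ->
  RInt (fun x => RInt (f x) 0 c) 0 b = RInt (fun y => RInt (fun x => f x y) 0 b) 0 c.
Proof.
  intros Hb Hc Hf.
  assert (Hf' : bounded_lip2 dR dR (fun y x => f x y)) by (apply bounded_lip2_sym; auto with bl).
  pose proof (bounded_lip2_RInt dR f 0 c dR_refl nneg_dR Hf) as B1.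
  pose proof (fun u v => bounded_lip2_RInt dR _ u v dR_refl nneg_dR Hf') as B2.
  assert (Cx : forall x, cts (f x)) by (intros; apply bounded_lip_cts; eapply bounded_lip2_r;
    eauto with bl).
  assert (Cy : forall y, cts (fun x => f x y)) by (intros;
    apply bounded_lip_cts, (bounded_lip2_l dR dR); auto with bl).
  pose proof (bounded_lip_cts _ B1) as C1.
  pose proof (fun u v => bounded_lip_cts _ (B2 u v)) as C2. simpl in C2.
  set (H := fun a => RInt (fun x => RInt (f x) 0 c) 0 a - RInt (fun y => RInt (fun x => f x y) 0 a) 0
    c).
  assert (HH : H b = H 0).
  { destruct B1 as (M1 & HM1 & _ & L1). destruct Hf as (M & HM & _ & L).
    (* [M1] is the remainder of the iterated integral with [x] outside; [c * M] is the pointwise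
       remainder [M] integrated over [y] in [0, c]. *)
    apply (quadratic_const H (M1 + c * M)); [easy|]. intros a h. unfold H.
    assert (E1 : RInt (fun x => RInt (f x) 0 c) 0 (a + h) =
                 RInt (fun x => RInt (f x) 0 c) 0 a + RInt (fun x => RInt (f x) 0 c) a (a + h))
      by (symmetry; apply (RInt_Chasles (V := R_CompleteNormedModule)); now apply cts_ex_RInt).
    assert (E2 : RInt (fun y => RInt (fun x => f x y) 0 (a + h)) 0 c =
                 RInt (fun y => RInt (fun x => f x y) 0 a) 0 c + RInt (fun y => RInt (fun x => f x y)
                   a (a + h)) 0 c).
    { rewrite <- (RInt_plus (V := R_CompleteNormedModule)) by now apply cts_ex_RInt.
      apply RInt_ext. intros y _. symmetry. apply (RInt_Chasles (V := R_CompleteNormedModule));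
        now apply cts_ex_RInt. }
    rewrite E1, E2.
    pose proof (RInt_dev (fun x => RInt (f x) 0 c) M1 a h HM1 C1 (fun t => L1 t a)) as D1.
    assert (D2 : Rabs (RInt (fun y => RInt (fun x => f x y) a (a + h)) 0 c - h * RInt (f a) 0 c) <= c
      * M * (h * h)).
    { rewrite <- (RInt_scal (V := R_CompleteNormedModule) (f a)) by now apply cts_ex_RInt.
      rewrite <- (RInt_minus (V := R_CompleteNormedModule));
        [|now apply cts_ex_RInt|apply cts_ex_RInt, (cts_mult (fun _ => h)); auto using cts_const].
      unfold minus, plus, opp, scal; simpl; unfold mult; simpl.
      rewrite Rmult_assoc. replace c with (c - 0) at 2 by ring.
      apply abs_RInt_le_const; [easy| |].
      - apply cts_ex_RInt, (cts_minus (fun y => RInt (fun x => f x y) a (a + h)) (fun t => h * f a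
        t)); auto.
        apply (cts_mult (fun _ => h)); auto using cts_const.
      - intros y _. apply (RInt_dev (fun x => f x y)); auto. intros t.
        specialize (L (t, y) (a, y)). unfold prod_dist in L. simpl in L.
        rewrite dR_refl, Rplus_0_r in L. exact L. }
    match goal with |- Rabs ?e <= _ => replace e with
      ((RInt (fun x => RInt (f x) 0 c) a (a + h) - h * RInt (f a) 0 c)
       - (RInt (fun y => RInt (fun x => f x y) a (a + h)) 0 c - h * RInt (f a) 0 c)) by ring end.
    apply Rle_trans with (1 := Rabs_triang _ _). rewrite Rabs_Ropp. lra. }
  assert (H0 : H 0 = 0).
  { unfold H. rewrite RInt_point. rewrite (RInt_ext _ (fun _ => 0)).
    - rewrite RInt_const. unfold zero, scal; simpl; unfold mult; simpl. ring.
    - intros y _. apply (RInt_point (V := R_CompleteNormedModule)). }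
  rewrite H0 in HH. unfold H in HH. lra.
Qed.

Lemma int1_swap (f : R -> R -> R) : bounded_lip2 dR dR f ->
  int1 (fun x => int1 (f x)) = int1 (fun y => int1 (fun x => f x y)).
Proof.
  intros Hf. pose proof two_PI_pos as H2.
  assert (E : forall g : R -> R -> R, bounded_lip2 dR dR g ->
    int1 (fun x => int1 (g x)) = RInt (fun x => RInt (g x) 0 (2*PI)) 0 (2*PI) / (2*PI) / (2*PI)).
  { intros g Hg. unfold int1 at 1. f_equal. unfold int1.
    rewrite (RInt_ext _ (fun x => / (2*PI) * RInt (g x) 0 (2*PI))) by (intros; unfold Rdiv;
      apply Rmult_comm).
    rewrite (RInt_scal (V := R_CompleteNormedModule) (fun x => RInt (g x) 0 (2*PI))).
    - unfold scal; simpl; unfold mult; simpl. unfold Rdiv. ring.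
    - apply cts_ex_RInt, bounded_lip_cts. apply bounded_lip2_RInt; auto with bl. }
  rewrite E by easy. rewrite (E (fun y x => f x y)) by (apply bounded_lip2_sym; auto with bl).
  now rewrite RInt_swap_bounded_lip by (auto; lra).
Qed.

Lemma int1_intS_swap n (F : R -> list R -> R) : bounded_lip2 dR (list_dist n) F ->
  int1 (fun t => intS n (F t)) = intS n (fun ys => int1 (fun t => F t ys)).
Proof.
  revert F. induction n as [|n IH]; intros F HF; [reflexivity|]. simpl.
  rewrite (int1_swap (fun t s => intS n (fun ys => F t (s :: ys)))).
  - f_equal. apply functional_extensionality. intros s. apply (IH (fun t ys => F t (s :: ys))).
    apply (bounded_lip_comp (prod_dist dR (list_dist (S n))) (prod_dist dR (list_dist n)) 1 (fun p =>
      (fst p, s :: snd p)) (fun p => F (fst p) (snd p))); auto with bl.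
    intros a b. unfold prod_dist. simpl fst; simpl snd. rewrite dl_cons, dR_refl. lra.
  - apply (bounded_lip2_intS n (prod_dist dR dR) (fun p ys => F (fst p) (snd p :: ys))); auto with bl.
    apply (bounded_lip_comp (prod_dist dR (list_dist (S n))) (prod_dist (prod_dist dR dR) (list_dist
      n)) 1
             (fun p => (fst (fst p), snd (fst p) :: snd p)) (fun p => F (fst p) (snd p))); auto with bl.
    intros a b. unfold prod_dist. simpl fst; simpl snd. rewrite dl_cons. lra.
Qed.

Lemma intS_swap n m (F : list R -> list R -> R) : bounded_lip2 (list_dist n) (list_dist m) F ->
  intS n (fun y => intS m (F y)) = intS m (fun z => intS n (fun y => F y z)).
Proof.
  revert F. induction n as [|n IH]; intros F HF; [reflexivity|]. simpl.
  rewrite <- (int1_intS_swap m (fun t z => intS n (fun y => F (t :: y) z))).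
  - f_equal. apply functional_extensionality. intros t. apply (IH (fun y z => F (t :: y) z)).
    apply (bounded_lip_comp (prod_dist (list_dist (S n)) (list_dist m)) (prod_dist (list_dist n)
      (list_dist m)) 1 (fun p => (t :: fst p, snd p)) (fun p => F (fst p) (snd p))); auto with bl.
    intros a b. unfold prod_dist. simpl fst; simpl snd. rewrite dl_cons, dR_refl. lra.
  - apply (bounded_lip2_intS n (prod_dist dR (list_dist m)) (fun p y => F (fst p :: y) (snd p)));
    auto with bl.
    apply (bounded_lip_comp (prod_dist (list_dist (S n)) (list_dist m)) (prod_dist (prod_dist dR
      (list_dist m)) (list_dist n)) 1
             (fun p => (fst (fst p) :: snd p, snd (fst p))) (fun p => F (fst p) (snd p))); auto with bl.
    intros a b. unfold prod_dist. simpl fst; simpl snd. rewrite dl_cons. lra.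
Qed.

(** * Averaging over the children *)

(** Half the Euclidean distance of the two points of the circle. It vanishes between [v] and
    [v + 2 * PI], so functions Lipschitz for it are automatically periodic. *)
Definition chord (a b : R) := Rabs (sin ((a - b) / 2)).

Lemma prodR_S n f : prodR (S n) f = f O * prodR n (fun j => f (S j)).
Proof. unfold prodR. simpl. now rewrite <- seq_shift, map_map. Qed.

Lemma prodR_pos n f : (forall j, 0 <= f j) -> 0 <= prodR n f.
Proof.
  revert f. induction n as [|n IH]; intros f H; [unfold prodR; simpl; lra|].
  rewrite prodR_S. apply Rmult_le_pos; auto.
Qed.

Lemma bounded_lip_prodR {X} (d : X -> X -> R) n (F : nat -> X -> R) : nonneg_dist d ->
  (forall j, (j < n)%nat -> bounded_lip d (F j)) -> bounded_lip d (fun x => prodR n (fun j => F j x)).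
Proof.
  intros Hd. revert F. induction n as [|n IH]; intros F H.
  - apply (bounded_lip_const d 1 Hd).
  - replace (fun x => prodR (S n) (fun j => F j x))
      with (fun x => F O x * prodR n (fun j => F (S j) x))
      by (apply functional_extensionality; intros x; now rewrite prodR_S).
    apply bounded_lip_mult; trivial. { apply H; lia. }
    apply (IH (fun j => F (S j))). intros j Hj. apply H. lia.
Qed.

Lemma sumN_term n f j : (forall i, 0 <= f i) -> (j < n)%nat -> f j <= sumN n f.
Proof.
  revert f j. induction n as [|n IH]; intros f j H Hj; [lia|]. simpl.
  pose proof (sumN_pos n (fun i => f (S i)) (fun i => H (S i))). pose proof (H O).
  destruct j as [|j]; [lra|].
  pose proof (IH (fun i => f (S i)) j (fun i => H (S i)) ltac:(lia)) as HI. simpl in HI. lra.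
Qed.

Lemma nth_dl n j y y' : (j < n)%nat -> dR (nth j y 0) (nth j y' 0) <= list_dist n y y'.
Proof.
  intros Hj. apply (sumN_term n (fun j => dR (nth j y 0) (nth j y' 0))); trivial. intros; apply nneg_dR.
Qed.

Lemma sumN_plus a b f : sumN (a + b) f = sumN a f + sumN b (fun j => f (a + j)%nat).
Proof.
  revert f. induction a as [|a IH]; intros f; simpl; [now rewrite Rplus_0_l|].
  rewrite (IH (fun j => f (S j))). simpl. ring.
Qed.

(** The nodes [j] with [j / q = i] are the [q] children of [i]: here the branching number enters.
    Induction on the number of parents: the first block of [q] indices has quotient 0, and the later
    ones are shifted by one. *)
Lemma sumN_div q n g : q <> 0%nat -> sumN (q * n) (fun j => g (j / q)%nat) = INR q * sumN n g.
Proof.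
  intros Hq. revert g. induction n as [|n IH]; intros g.
  - rewrite Nat.mul_0_r. simpl. ring.
  - rewrite Nat.mul_succ_r, Nat.add_comm, sumN_plus. simpl sumN at 3.
    rewrite (sumN_ext q _ (fun _ => g O)) by (intros j Hj; now rewrite Nat.div_small).
    rewrite sumN_const.
    rewrite (sumN_ext (q * n) _ (fun j => g (S (j / q)))).
    + rewrite (IH (fun j => g (S j))). ring.
    + intros j _. f_equal. replace (q + j)%nat with (j + 1 * q)%nat by lia.
      rewrite Nat.div_add by easy. lia.
Qed.

(** The sign of [F] is discontinuous and would leave the class on which [intS] can be handled; this
    quotient stays in it for every [e > 0]. *)
Lemma bounded_lip_sgn_approx {X} (d : X -> X -> R) (F : X -> R) e : nonneg_dist d -> 0 < e ->
  bounded_lip d F ->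
  bounded_lip d (fun x => F x / (Rabs (F x) + e)).
Proof.
  intros Hd He HF. apply (bounded_lip_mult d F (fun x => / (Rabs (F x) + e))); trivial.
  destruct (bounded_lip_abs d F HF) as (M & HM & _ & HL).
  assert (Hp : forall x, 0 < Rabs (F x) + e) by (intros x; pose proof (Rabs_pos (F x)); lra).
  assert (Hi : 0 < / e) by now apply Rinv_0_lt_compat.
  assert (Hle : forall x, Rabs (/ (Rabs (F x) + e)) <= / e).
  { intros x. rewrite Rabs_right by (apply Rle_ge, Rlt_le, Rinv_0_lt_compat, Hp).
    apply Rinv_le_contravar; trivial. pose proof (Rabs_pos (F x)); lra. }
  assert (0 <= M * (/ e * / e)) by (apply Rmult_le_pos; nra).
  exists (/ e + M * (/ e * / e)). split; [lra|]. split.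
  - intros a. specialize (Hle a). lra.
  - intros a b. pose proof (Hp a). pose proof (Hp b).
    replace (/ (Rabs (F a) + e) - / (Rabs (F b) + e)) with
      (- (Rabs (F a) - Rabs (F b)) * (/ (Rabs (F a) + e) * / (Rabs (F b) + e))) by (field; lra).
    rewrite !Rabs_mult, Rabs_Ropp.
    apply Rle_trans with ((M * d a b) * (/ e * / e)).
    + apply Rmult_le_compat; auto using Rabs_pos.
      * apply Rmult_le_pos; apply Rabs_pos.
      * apply Rmult_le_compat; auto using Rabs_pos.
    + pose proof (Hd a b). assert (0 <= / e * d a b) by (apply Rmult_le_pos; lra). lra.
Qed.

Section Kernel.

Variable ph : R -> R -> R.
Hypothesis ph_bounded_lip : bounded_lip2 dR dR ph.
Hypothesis ph_pos : forall x y, 0 <= ph x y.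
Hypothesis ph_int : forall x, int1 (ph x) = 1.

(** The expectation of [f] at independent labels, the [j]-th of law [ph (p j)]. The base points are
    an arbitrary function [p], so siblings may share one and the induction can shift the index. *)
Definition kernel_op (n : nat) (p : nat -> R) (f : list R -> R) : R :=
  intS n (fun y => prodR n (fun j => ph (p j) (nth j y 0)) * f y).

Lemma bounded_lip_ph {X} (d : X -> X -> R) (u v : X -> R) : nonneg_dist d ->
  (forall a b, dR (u a) (u b) <= d a b) -> (forall a b, dR (v a) (v b) <= d a b) ->
  bounded_lip d (fun x => ph (u x) (v x)).
Proof.
  intros Hd Hu Hv.
  apply (bounded_lip_comp (prod_dist dR dR) d 2 (fun x => (u x, v x)) (fun p => ph (fst p) (snd p)));
    trivial.
  intros a b. unfold prod_dist; simpl. specialize (Hu a b). specialize (Hv a b). lra.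
Qed.

Lemma ph_cts x : cts (ph x).
Proof. apply bounded_lip_cts. apply (bounded_lip_ph dR (fun _ => x) (fun t => t)); auto with bl.
intros; rewrite dR_refl; auto with bl. intros; lra. Qed.

Lemma bounded_lip_prod_ph n p : bounded_lip (list_dist n) (fun y => prodR n (fun j => ph (p j) (nth j
  y 0))).
Proof.
  apply (bounded_lip_prodR (list_dist n) n (fun j y => ph (p j) (nth j y 0))); auto with bl.
  intros j Hj. apply (bounded_lip_ph (list_dist n) (fun _ => p j) (fun y => nth j y 0)); auto with bl.
  - intros. rewrite dR_refl. apply nneg_dl.
  - intros. now apply nth_dl.
Qed.
Hint Resolve bounded_lip_prod_ph : bl.

Lemma kernel_op_S n p f : bounded_lip (list_dist (S n)) f ->
  kernel_op (S n) p f = int1 (fun t => ph (p O) t * kernel_op n (fun j => p (S j)) (fun ys => f (t ::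
    ys))).
Proof.
  intros Hf. unfold kernel_op at 1. simpl. f_equal. apply functional_extensionality. intros t.
  unfold kernel_op. rewrite <- intS_scal by auto with bl.
  f_equal. apply functional_extensionality. intros ys. rewrite prodR_S. simpl. ring.
Qed.

Lemma kernel_op_const n p c : kernel_op n p (fun _ => c) = c.
Proof.
  revert p. induction n as [|n IH]; intros p.
  - unfold kernel_op; simpl. unfold prodR; simpl. ring.
  - rewrite kernel_op_S by auto with bl.
    replace (fun t => ph (p O) t * kernel_op n (fun j => p (S j)) (fun _ => c)) with (fun t => c * ph
      (p O) t).
    + rewrite int1_scal by apply ph_cts. rewrite ph_int. ring.
    + apply functional_extensionality. intros t. rewrite IH. ring.
Qed.

Lemma kernel_op_minus n p f g : bounded_lip (list_dist n) f -> bounded_lip (list_dist n) g ->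
  kernel_op n p f - kernel_op n p g = kernel_op n p (fun y => f y - g y).
Proof.
  intros Hf Hg. unfold kernel_op. rewrite <- intS_minus by auto with bl.
  f_equal. apply functional_extensionality. intros y. ring.
Qed.

Lemma kernel_op_abs_le n p f c : bounded_lip (list_dist n) f -> (forall y, Rabs (f y) <= c) ->
  Rabs (kernel_op n p f) <= c.
Proof.
  intros Hf H. rewrite <- (kernel_op_const n p c). apply intS_abs_le; auto with bl.
  intros y. rewrite Rabs_mult. assert (0 <= prodR n (fun j => ph (p j) (nth j y 0)))
    by (apply prodR_pos; auto).
  rewrite Rabs_right by lra. now apply Rmult_le_compat_l.
Qed.

(* The coordinates are changed one at a time; the hypothesis on one-dimensional
   averages is used once for each of them. *)
Lemma kernel_op_lip (rho tau : R -> R -> R) :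
  (forall a, rho a a = 0) ->
  (forall g, bounded_lip dR g -> (forall t t', Rabs (g t - g t') <= rho t t') ->
     forall x x', Rabs (int1 (fun t => ph x t * g t) - int1 (fun t => ph x' t * g t)) <= tau x x') ->
  forall n p p' f, bounded_lip (list_dist n) f -> (forall y y', Rabs (f y - f y') <= dsum rho n y y') ->
  Rabs (kernel_op n p f - kernel_op n p' f) <= sumN n (fun j => tau (p j) (p' j)).
Proof.
  intros Hrho H1. induction n as [|n IH]; intros p p' f Hf HL.
  - unfold kernel_op; simpl. unfold prodR; simpl. rewrite Rminus_diag, Rabs_R0. lra.
  - rewrite !kernel_op_S by easy. simpl sumN.
    assert (HB : forall p, bounded_lip dR (fun t => kernel_op n (fun j => p (S j)) (fun ys => f (t ::
      ys)))).
    { intros p0. apply (bounded_lip2_intS n dR (fun t y => prodR n (fun j => ph (p0 (S j)) (nth j y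
      0)) * f (t :: y))); auto with bl.
      unfold bounded_lip2. apply bounded_lip_mult; auto with bl.
      - apply (bounded_lip_comp (list_dist n) (prod_dist dR (list_dist n)) 1 snd (fun y => prodR n
        (fun j => ph (p0 (S j)) (nth j y 0)))); auto with bl.
        intros a b. unfold prod_dist. pose proof (nneg_dR (fst a) (fst b)). lra.
      - now apply bounded_lip_cons2. }
    assert (Hself : forall ys, dsum rho n ys ys = 0).
    { intros ys. unfold dsum. rewrite (sumN_ext _ _ (fun _ => 0)) by (intros; apply Hrho).
      rewrite sumN_const. ring. }
    pose proof (HB p) as HBp. pose proof (HB p') as HBp'.
    set (g := fun t => kernel_op n (fun j => p (S j)) (fun ys => f (t :: ys))) in *.
    set (g' := fun t => kernel_op n (fun j => p' (S j)) (fun ys => f (t :: ys))) in *.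
    assert (Hgg : forall t, Rabs (g t - g' t) <= sumN n (fun j => tau (p (S j)) (p' (S j)))).
    { intros t. apply (IH (fun j => p (S j)) (fun j => p' (S j))); auto with bl.
      intros y y'. apply Rle_trans with (1 := HL (t :: y) (t :: y')).
      unfold dsum at 1. simpl. rewrite Hrho. unfold dsum. lra. }
    (* Averaging over the other coordinates keeps the modulus [rho] in the first one, so the
       one-dimensional hypothesis applies to [g']. *)
    assert (Hg' : forall t t', Rabs (g' t - g' t') <= rho t t').
    { intros t t'. unfold g'. rewrite kernel_op_minus by auto with bl.
    apply kernel_op_abs_le; auto with bl.
      intros ys. apply Rle_trans with (1 := HL (t :: ys) (t' :: ys)).
      unfold dsum. simpl. fold (dsum rho n ys ys). rewrite Hself. lra. }
    pose proof (H1 g' HBp' Hg' (p O) (p' O)) as K1.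
    assert (K2 : Rabs (int1 (fun t => ph (p O) t * g t) - int1 (fun t => ph (p O) t * g' t))
                 <= sumN n (fun j => tau (p (S j)) (p' (S j)))).
    { pose proof (ph_cts (p O)) as Hc. pose proof (bounded_lip_cts _ HBp).
    pose proof (bounded_lip_cts _ HBp').
      rewrite <- int1_minus by auto using cts_mult.
      set (c := sumN n (fun j => tau (p (S j)) (p' (S j)))) in *.
      replace c with (int1 (fun t => c * ph (p O) t)) by (rewrite int1_scal, ph_int by easy; ring).
      apply int1_abs_le; auto using cts_mult, cts_minus, cts_const.
      intros t _. rewrite <- Rmult_minus_distr_l, Rabs_mult, (Rabs_right (ph _ _))
        by (apply Rle_ge, ph_pos).
      rewrite Rmult_comm. apply Rmult_le_compat_r; auto. }
    change (Rabs (int1 (fun t => ph (p O) t * g t) - int1 (fun t => ph (p' O) t * g' t))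
            <= tau (p O) (p' O) + sumN n (fun j => tau (p (S j)) (p' (S j)))).
    replace (int1 (fun t => ph (p O) t * g t) - int1 (fun t => ph (p' O) t * g' t)) with
      ((int1 (fun t => ph (p O) t * g' t) - int1 (fun t => ph (p' O) t * g' t)) +
       (int1 (fun t => ph (p O) t * g t) - int1 (fun t => ph (p O) t * g' t))) by ring.
    apply Rle_trans with (1 := Rabs_triang _ _). lra.
Qed.

End Kernel.
#[local] Hint Resolve bounded_lip_prod_ph : bl.

(** * Recursion along the levels of the tree, and duality *)

Section Tree.

Variables (q : nat) (beta lam C : R).
Hypothesis q_pos : q <> 0%nat.
Hypothesis phi_bounded_lip : bounded_lip2 dR dR (phi beta).
Hypothesis phi_pos : forall x y, 0 <= phi beta x y.
Hypothesis phi_int : forall x, int1 (phi beta x) = 1.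
Hypothesis phi_contr : forall (g : R -> R) c, bounded_lip dR g -> 
  (forall t t', Rabs (g t - g t') <= c * chord t t') ->
  forall x x', Rabs (int1 (fun t => phi beta x t * g t) - int1 (fun t => phi beta x' t * g t)) <= c *
    lam * chord x x'.
(** Stated through the oscillation because that is what Lipschitz continuity for the discrete
    distance of value [2 * 1] gives in [level_smooth]. *)
Hypothesis phi_smooth : forall (g : R -> R), bounded_lip dR g -> 
  (forall t t', Rabs (g t - g t') <= 2) ->
  forall x x', Rabs (int1 (fun t => phi beta x t * g t) - int1 (fun t => phi beta x' t * g t)) <= C *
    chord x x'.

Lemma chord_refl a : chord a a = 0.
Proof. unfold chord. rewrite Rminus_diag. unfold Rdiv. rewrite Rmult_0_l, sin_0. apply Rabs_R0. Qed.

(** The conditional expectation of [f] at the labels of a level of [n] nodes, given the labels [z]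
    of the level above. *)
Definition level (n : nat) (f : list R -> R) (z : list R) : R :=
  kernel_op (phi beta) n (fun j => nth (j / q) z 0) f.

Lemma level_contr m c f : bounded_lip (list_dist (q * m)) f ->
  (forall y y', Rabs (f y - f y') <= c * dsum chord (q * m) y y') ->
  forall z z', Rabs (level (q * m) f z - level (q * m) f z') <= c * (INR q * lam) * dsum chord m z z'.
Proof.
  intros Hf HL z z'.
  pose proof (kernel_op_lip (phi beta) phi_bounded_lip phi_pos phi_int (fun a b => c * chord a b)
    (fun a b => c * lam * chord a b)) as H.
  eapply Rle_trans.
  - apply H; trivial.
    + intros a. rewrite chord_refl; ring.
    + intros g Hg Hg'. now apply phi_contr.
    + intros y y'. unfold dsum. rewrite sumN_scal. apply HL.
  - cbv beta. rewrite (sumN_div q m (fun i => c * lam * chord (nth i z 0) (nth i z' 0))) by easy.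
    rewrite sumN_scal. unfold dsum. apply Req_le. ring.
Qed.

(** If some entry differs, the discrete sum is at least [2 * M], which bounds the oscillation. If
    the first [n] entries agree, [f] takes the same value, because it is Lipschitz for
    [list_dist n]. *)
Lemma bounded_lip_dsum_discrete n f M : bounded_lip (list_dist n) f -> (forall y, Rabs (f y) <= M) -> 
  forall y y', Rabs (f y - f y') <= dsum (fun a b => if Req_EM_T a b then 0 else 2 * M) n y y'.
Proof.
  intros (L & HL & _ & H2) HM y y'.
  assert (HM0 : 0 <= M) by (apply Rle_trans with (2 := HM nil), Rabs_pos).
  assert (Hd : list_dist n y y' = 0 \/ 2 * M <= dsum (fun a b => if Req_EM_T a b then 0 else 2 * M) n
    y y').
  { unfold list_dist, dsum. enough (HG : forall u v : nat -> R, sumN n (fun j => dR (u j) (v j)) = 0 \/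
      2 * M <= sumN n (fun j => if Req_EM_T (u j) (v j) then 0 else 2 * M)) by apply HG.
    clear - HM0.
    induction n as [|n IH]; intros u v; simpl; [now left|].
    assert (0 <= sumN n (fun j => if Req_EM_T (u (S j)) (v (S j)) then 0 else 2 * M)).
    { apply sumN_pos. intros j. destruct (Req_EM_T _ _); lra. }
    destruct (Req_EM_T (u O) (v O)) as [E|E]; [|right; lra].
    destruct (IH (fun j => u (S j)) (fun j => v (S j))) as [I|I]; simpl in I.
    - left. rewrite I, E, dR_refl. ring.
    - right. lra. }
  destruct Hd as [Hd|Hd].
  - specialize (H2 y y'). rewrite Hd in H2. apply Rle_trans with (1 := H2). rewrite Rmult_0_r.
    apply sumN_pos. intros j. cbv beta. destruct (Req_EM_T (nth j y 0) (nth j y' 0)); lra.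
  - apply Rle_trans with (2 := Hd). pose proof (HM y). pose proof (HM y').
    apply Rle_trans with (1 := Rabs_triang _ _). rewrite Rabs_Ropp. lra.
Qed.

Lemma level_smooth m f : bounded_lip (list_dist (q * m)) f -> (forall y, Rabs (f y) <= 1) -> 
  forall z z', Rabs (level (q * m) f z - level (q * m) f z') <= C * INR q * dsum chord m z z'.
Proof.
  intros Hf HM z z'.
  pose proof (kernel_op_lip (phi beta) phi_bounded_lip phi_pos phi_int
     (fun a b => if Req_EM_T a b then 0 else 2 * 1) (fun a b => C * chord a b)) as H.
  eapply Rle_trans.
  - apply H; trivial.
    + intros a. destruct (Req_EM_T a a); lra.
    + intros g Hg Hg'. apply phi_smooth; trivial. intros t t'. specialize (Hg' t t').
      destruct (Req_EM_T t t'); lra.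
    + now apply bounded_lip_dsum_discrete.
  - cbv beta. rewrite (sumN_div q m (fun i => C * chord (nth i z 0) (nth i z' 0))) by easy.
    rewrite sumN_scal. unfold dsum. apply Req_le. ring.
Qed.

Lemma bounded_lip2_level_kernel m :
  bounded_lip2 (list_dist m) (list_dist (q * m)) (fun z y => prodR (q * m) (fun j => phi beta (nth (j
    / q) z 0) (nth j y 0))).
Proof.
  apply (bounded_lip_prodR (prod_dist (list_dist m) (list_dist (q * m))) (q * m)
          (fun j p => phi beta (nth (j / q) (fst p) 0) (nth j (snd p) 0))); auto with bl.
  intros j Hj. apply (bounded_lip_ph _ phi_bounded_lip (prod_dist (list_dist m) (list_dist (q * m)))
     (fun p => nth (j / q) (fst p) 0) (fun p => nth j (snd p) 0)); auto with bl.
  - intros a b. unfold prod_dist. pose proof (nneg_dl (q * m) (snd a) (snd b)).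
    assert (j / q < m)%nat by (apply Nat.Div0.div_lt_upper_bound; lia).
    pose proof (nth_dl m (j / q) (fst a) (fst b) ltac:(easy)). lra.
  - intros a b. unfold prod_dist. pose proof (nneg_dl m (fst a) (fst b)).
    pose proof (nth_dl (q * m) j (snd a) (snd b) Hj). lra.
Qed.

Lemma bounded_lip2_dens k : bounded_lip2 dR (list_dist (q ^ S k)) (dens q beta k).
Proof.
  induction k as [|k IH].
  - rewrite Nat.pow_1_r. 
    apply (bounded_lip_prodR (prod_dist dR (list_dist q)) q (fun j p => phi beta (fst p) (nth j (snd
      p) 0))); auto with bl.
    intros j Hj. apply (bounded_lip_ph _ phi_bounded_lip (prod_dist dR (list_dist q)) fst (fun p =>
      nth j (snd p) 0)); auto with bl.
    + intros a b. unfold prod_dist. pose proof (nneg_dl q (snd a) (snd b)). lra.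
    + intros a b. unfold prod_dist. pose proof (nneg_dR (fst a) (fst b)).
    pose proof (nth_dl q j (snd a) (snd b) Hj). lra.
  - change (q ^ S (S k))%nat with (q * q ^ S k)%nat. set (m := (q ^ S k)%nat) in *.
    apply (bounded_lip2_intS m (prod_dist dR (list_dist (q * m)))
      (fun p z => dens q beta k (fst p) z * prodR (q * m) (fun j => phi beta (nth (j / q) z 0) (nth j
        (snd p) 0)))); auto with bl.
    apply bounded_lip_mult; auto with bl.
    + apply (bounded_lip_comp (prod_dist dR (list_dist m)) (prod_dist (prod_dist dR (list_dist (q *
      m))) (list_dist m)) 1
        (fun p => (fst (fst p), snd p)) (fun p => dens q beta k (fst p) (snd p))); auto with bl.
      intros a b. unfold prod_dist; simpl. pose proof (nneg_dl (q*m) (snd (fst a)) (snd (fst b))). lra.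
    + apply (bounded_lip_comp (prod_dist (list_dist m) (list_dist (q * m))) (prod_dist (prod_dist dR
      (list_dist (q * m))) (list_dist m)) 1
        (fun p => (snd p, snd (fst p))) (fun p => prodR (q * m) (fun j => phi beta (nth (j / q) (fst
          p) 0) (nth j (snd p) 0)))); auto with bl.
      * intros a b. unfold prod_dist; simpl. pose proof (nneg_dR (fst (fst a)) (fst (fst b))). lra.
      * apply bounded_lip2_level_kernel.
Qed.

Lemma dens_pos k x y : 0 <= dens q beta k x y.
Proof.
  revert x y. induction k as [|k IH]; intros x y; cbn [dens].
  - apply prodR_pos; auto.
  - change (q ^ S (S k))%nat with (q * q ^ S k)%nat. set (m := (q ^ S k)%nat).
    apply Rle_trans with (intS m (fun _ => 0)); [rewrite intS_const; lra|]. apply intS_le; auto with bl.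
    + apply bounded_lip_mult; auto with bl.
      * exact (bounded_lip2_r dR (list_dist m) (dens q beta k) x (nneg_dl m) (dR_refl x)
        (bounded_lip2_dens k)).
      * exact (bounded_lip2_l (list_dist m) (list_dist (q * m)) _ y (nneg_dl m) (dl_refl _ y)
        (bounded_lip2_level_kernel m)).
    + intros z. apply Rmult_le_pos; auto. apply prodR_pos; auto.
Qed.

(** The conditional expectation of [f] at the labels of depth [k + 1], given the root label [x]. *)
Definition pairing (k : nat) (f : list R -> R) (x : R) : R :=
  intS (q ^ S k) (fun y => dens q beta k x y * f y).

Lemma bounded_lip_level m f : bounded_lip (list_dist (q * m)) f ->
  bounded_lip (list_dist m) (level (q * m) f).
Proof.
  intros Hf. unfold level, kernel_op.
  apply (bounded_lip2_intS (q * m) (list_dist m)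
     (fun z y => prodR (q * m) (fun j => phi beta (nth (j / q) z 0) (nth j y 0)) * f y)); auto with bl.
  apply bounded_lip_mult; auto with bl.
  - apply bounded_lip2_level_kernel.
  - apply (bounded_lip_comp (list_dist (q * m)) (prod_dist (list_dist m) (list_dist (q * m))) 1 snd
    f); auto with bl.
    intros a b. unfold prod_dist. pose proof (nneg_dl m (fst a) (fst b)). lra.
Qed.

Lemma pairing_0 f x : pairing 0 f x = level (q * 1) f (x :: nil).
Proof.
  unfold pairing, level, kernel_op. change (q ^ 1)%nat with (q * 1)%nat. rewrite Nat.mul_1_r.
  f_equal. apply functional_extensionality. intros y. simpl dens. f_equal.
  unfold prodR. f_equal. apply map_ext_in. intros j Hj. apply in_seq in Hj.
  now rewrite Nat.div_small by lia.
Qed.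

(** The Markov property: after exchanging the two integrals the lowest level is integrated first,
    and [f] is replaced by its average given the level above. *)
Lemma pairing_S k f x : bounded_lip (list_dist (q ^ S (S k))) f ->
  pairing (S k) f x = pairing k (level (q ^ S (S k)) f) x.
Proof.
  change (q ^ S (S k))%nat with (q * q ^ S k)%nat. intros Hf.
  unfold pairing. change (q ^ S (S k))%nat with (q * q ^ S k)%nat.
  pose proof (bounded_lip2_dens k) as HD. pose proof (bounded_lip2_level_kernel (q ^ S k)) as HK.
  cbn [dens]. change (q ^ S (S k))%nat with (q * q ^ S k)%nat. set (m := (q ^ S k)%nat) in *.
  pose proof (fun x => bounded_lip2_r dR (list_dist m) (dens q beta k) x (nneg_dl m) (dR_refl x) HD)
    as HD1.
  pose proof (fun y => bounded_lip2_l (list_dist m) (list_dist (q * m)) _ y (nneg_dl m) (dl_refl _ y)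
    HK) as HK1.
  pose proof (fun z => bounded_lip2_r (list_dist m) (list_dist (q * m)) _ z (nneg_dl _) (dl_refl _ z)
    HK) as HK2.
  simpl in HK1, HK2.
  set (G := fun y z => (dens q beta k x z * f y) * prodR (q * m) (fun j => phi beta (nth (j / q) z 0)
    (nth j y 0))).
  transitivity (intS (q * m) (fun y => intS m (G y))).
  { f_equal. apply functional_extensionality. intros y.
    rewrite Rmult_comm, <- intS_scal by auto with bl.
    f_equal. apply functional_extensionality. intros z. unfold G. ring. }
  rewrite intS_swap.
  - f_equal. apply functional_extensionality. intros z. unfold level, kernel_op.
    rewrite <- intS_scal by auto with bl.
    f_equal. apply functional_extensionality. intros y. unfold G. ring.
  - unfold G. apply bounded_lip_mult; auto with bl; [apply bounded_lip_mult; auto with bl|].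
    + apply (bounded_lip_comp (list_dist m) (prod_dist (list_dist (q * m)) (list_dist m)) 1 snd (dens
      q beta k x)); auto with bl.
      intros a b. unfold prod_dist. pose proof (nneg_dl (q * m) (fst a) (fst b)). lra.
    + apply (bounded_lip_comp (list_dist (q * m)) (prod_dist (list_dist (q * m)) (list_dist m)) 1 fst
      f); auto with bl.
      intros a b. unfold prod_dist. pose proof (nneg_dl m (snd a) (snd b)). lra.
    + apply (bounded_lip2_sym (list_dist m) (list_dist (q * m)) _ (nneg_dl _) (nneg_dl _) HK).
Qed.

Lemma dsum_single x x' : dsum chord 1 (x :: nil) (x' :: nil) = chord x x'.
Proof. unfold dsum; simpl. ring. Qed.

(** The constant [c] is quantified inside the induction, because each level removed from below
    replaces it by [c * (INR q * lam)]. *)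
Lemma pairing_contr k : forall c f, bounded_lip (list_dist (q ^ S k)) f ->
  (forall y y', Rabs (f y - f y') <= c * dsum chord (q ^ S k) y y') ->
  forall x x', Rabs (pairing k f x - pairing k f x') <= c * (INR q * lam) ^ S k * chord x x'.
Proof.
  induction k as [|k IH]; intros c f Hf HL x x'.
  - rewrite !pairing_0, <- dsum_single.
    change (q ^ 1)%nat with (q * 1)%nat in *. rewrite pow_1. now apply level_contr.
  - rewrite !pairing_S by easy. change (q ^ S (S k))%nat with (q * q ^ S k)%nat in *.
    replace (c * (INR q * lam) ^ S (S k)) with (c * (INR q * lam) * (INR q * lam) ^ S k) by (simpl;
      ring).
    apply IH; [now apply bounded_lip_level|]. now apply level_contr.
Qed.

(** Depth [k + 1] gives only the power [k]: the lowest level is spent on turning a bounded function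
    into a Lipschitz one, at the price [C * INR q]. *)
Lemma pairing_bound k f : bounded_lip (list_dist (q ^ S k)) f -> (forall y, Rabs (f y) <= 1) ->
  forall x x', Rabs (pairing k f x - pairing k f x') <= C * INR q * (INR q * lam) ^ k * chord x x'.
Proof.
  intros Hf HM x x'. destruct k as [|k].
  - rewrite !pairing_0, <- dsum_single.
    change (q ^ 1)%nat with (q * 1)%nat in *. rewrite pow_O, Rmult_1_r. now apply level_smooth.
  - rewrite !pairing_S by easy. change (q ^ S (S k))%nat with (q * q ^ S k)%nat in *.
    apply pairing_contr; [now apply bounded_lip_level|]. now apply level_smooth.
Qed.

Lemma chord_le_1 x y : chord x y <= 1.
Proof. apply Rabs_le. apply SIN_bound. Qed.

Lemma bounded_lip_marg k : bounded_lip (list_dist (q ^ S k)) (marg q beta k).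
Proof.
  apply (bounded_lip2_int1 (list_dist (q ^ S k)) (fun y x => dens q beta k x y)); auto with bl.
  apply bounded_lip2_sym; auto using bounded_lip2_dens with bl.
Qed.

Lemma bounded_lip2_dens_dev k :
  bounded_lip2 dR (list_dist (q ^ S k)) (fun x y => Rabs (dens q beta k x y - marg q beta k y)).
Proof.
  apply bounded_lip_abs, bounded_lip_minus; [auto with bl|apply bounded_lip2_dens|].
  apply (bounded_lip_comp (list_dist (q ^ S k)) (prod_dist dR (list_dist (q ^ S k))) 1 snd (marg q
    beta k)); auto using bounded_lip_marg with bl.
  intros a b. unfold prod_dist. pose proof (nneg_dR (fst a) (fst b)). lra.
Qed.

(* Also valid where [marg] vanishes: there [dens] integrates to [0] in [x]. *)
Lemma marg_tv k y : marg q beta k y * tv_unif (cond_dens q beta k y)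
  = / 2 * int1 (fun x => Rabs (dens q beta k x y - marg q beta k y)).
Proof.
  pose proof (bounded_lip2_dens k) as HD.
  assert (Hc : cts (fun x => dens q beta k x y))
    by (apply bounded_lip_cts, (bounded_lip2_l dR (list_dist (q ^ S k))); auto with bl).
  assert (Hm : 0 <= marg q beta k y).
  { unfold marg. rewrite <- (int1_const 0). apply int1_le; auto using cts_const.
  intros; apply dens_pos. }
  unfold tv_unif, cond_dens.
  destruct (Req_dec (marg q beta k y) 0) as [E|E].
  - rewrite E, Rmult_0_l.
    replace (fun x => Rabs (dens q beta k x y - 0)) with (fun x => dens q beta k x y).
    + unfold marg in E. rewrite E. ring.
    + apply functional_extensionality. intros x. rewrite Rminus_0_r, Rabs_right; trivial.
      apply Rle_ge, dens_pos.
  - rewrite <- Rmult_assoc, (Rmult_comm _ (/ 2)), Rmult_assoc. f_equal.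
    rewrite <- int1_scal.
    + f_equal. apply functional_extensionality. intros x.
      rewrite <- (Rabs_right (marg q beta k y)) at 1 by lra. rewrite <- Rabs_mult. f_equal. field.
      exact E.
    + apply cts_abs. apply (cts_minus (fun x => dens q beta k x y / marg q beta k y) (fun _ => 1));
      auto using cts_const.
      apply (cts_mult (fun x => dens q beta k x y) (fun _ => / marg q beta k y)); auto using cts_const.
Qed.

(* Duality against [f = D / (|D| + e)], a Lipschitz substitute for the sign of the
   deviation [D]: the pointwise loss [|D| - D f] is at most [e]. *)
Lemma dual_bound k x e : 0 < e -> 0 <= C -> 0 <= lam ->
  intS (q ^ S k) (fun y => Rabs (dens q beta k x y - marg q beta k y))
  <= C * INR q * (INR q * lam) ^ k + e.
Proof.
  intros He HC Hlam. pose proof (bounded_lip2_dens k) as HD. set (N := (q ^ S k)%nat) in *.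
  pose proof (fun x => bounded_lip2_r dR (list_dist N) (dens q beta k) x (nneg_dl N) (dR_refl x) HD)
    as HD1.
  pose proof (bounded_lip_marg k) as HM. fold N in HM.
  set (D := fun y => dens q beta k x y - marg q beta k y).
  assert (HDD : bounded_lip (list_dist N) D) by (unfold D; auto with bl).
  set (f := fun y => D y / (Rabs (D y) + e)).
  assert (Hp : forall y, 0 < Rabs (D y) + e) by (intros y; pose proof (Rabs_pos (D y)); lra).
  assert (Hf : bounded_lip (list_dist N) f) by (apply bounded_lip_sgn_approx; auto with bl).
  assert (Hf1 : forall y, Rabs (f y) <= 1).
  { intros y. unfold f, Rdiv. specialize (Hp y). rewrite Rabs_mult, Rabs_inv, (Rabs_right (_ + e))
    by lra.
    apply (Rmult_le_reg_r (Rabs (D y) + e)); [easy|]. rewrite Rmult_assoc, Rinv_l by lra. lra. }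
  set (B := C * INR q * (INR q * lam) ^ k).
  assert (HB : 0 <= B).
  { unfold B. pose proof (pos_INR q). apply Rmult_le_pos; [nra|]. apply pow_le; nra. }
  apply Rle_trans with (intS N (fun y => 1 * (D y * f y) + e * 1)).
  { apply intS_le; auto with bl. intros y. fold (D y). unfold f. specialize (Hp y).
    assert (Hs : D y * D y = Rabs (D y) * Rabs (D y)) by (rewrite <- Rabs_mult; symmetry;
      apply Rabs_right; nra).
    apply (Rmult_le_reg_r (Rabs (D y) + e)); [easy|].
    replace ((1 * (D y * (D y / (Rabs (D y) + e))) + e * 1) * (Rabs (D y) + e))
      with (D y * D y + e * (Rabs (D y) + e)) by (field; lra).
    rewrite Hs. nra. }
  rewrite intS_lin, intS_const by auto with bl.
  enough (intS N (fun y => D y * f y) <= B) by lra.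
  assert (HX : bounded_lip2 dR (list_dist N) (fun x y => dens q beta k x y * f y)).
  { apply bounded_lip_mult; auto with bl.
    apply (bounded_lip_comp (list_dist N) (prod_dist dR (list_dist N)) 1 snd f); auto with bl.
    intros a b. unfold prod_dist. pose proof (nneg_dR (fst a) (fst b)). lra. }
  assert (HP : bounded_lip dR (pairing k f)) by (apply (bounded_lip2_intS N dR (fun x y => dens q
    beta k x y * f y)); auto with bl).
  (* [marg] is the average of [dens] over the root label, so testing [D] against [f] gives the
     average over [x'] of a difference of conditional expectations; only the oscillation of
     [pairing k f] matters. *)
  replace (intS N (fun y => D y * f y)) with (int1 (fun x' => pairing k f x - pairing k f x')).
  - rewrite <- (int1_const B). apply int1_le; auto using cts_const.
    + apply cts_minus; auto using cts_const with bl.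
    + intros x' _. apply Rle_trans with (1 := Rle_abs _).
      apply Rle_trans with (1 := pairing_bound k f Hf Hf1 x x'). fold B.
      rewrite <- (Rmult_1_r B) at 2. apply Rmult_le_compat_l; [easy|apply chord_le_1].
  - rewrite (int1_minus (fun _ => pairing k f x)), int1_const by auto using cts_const with bl.
    unfold pairing at 2. fold N. rewrite (int1_intS_swap N (fun x' y => dens q beta k x' y * f y))
      by easy.
    unfold pairing. fold N. rewrite <- intS_minus; auto with bl.
    + f_equal. apply functional_extensionality. intros y. unfold D.
      assert (Hc : cts (fun x => dens q beta k x y))
        by (apply bounded_lip_cts, (bounded_lip2_l dR (list_dist N)); auto with bl).
      replace (fun t => dens q beta k t y * f y) with (fun t => f y * dens q beta k t y)
        by (apply functional_extensionality; intros; ring).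
      rewrite int1_scal by easy. unfold marg. ring.
    + apply (bounded_lip2_int1 (list_dist N) (fun y x => dens q beta k x y * f y)); auto with bl.
      apply (bounded_lip2_sym dR (list_dist N)); auto with bl.
Qed.

(** By [marg_tv] and an exchange of integrals the expected distance is half the average, over root
    labels [x], of the L1 norm in [dual_bound]. The factor one half is given away. *)
Lemma exp_tv_bound k : 0 <= C -> 0 <= lam ->
  0 <= exp_tv q beta (S k) <= C * INR q * (INR q * lam) ^ k.
Proof.
  intros HC Hlam. pose proof (bounded_lip2_dens k) as HD.
  assert (E : exp_tv q beta (S k) =
    / 2 * int1 (fun x => intS (q ^ S k) (fun y => Rabs (dens q beta k x y - marg q beta k y)))).
  { unfold exp_tv. set (N := (q ^ S k)%nat) in *.
    pose proof (bounded_lip2_dens_dev k) as HA. fold N in HA.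
    rewrite (int1_intS_swap N (fun x y => Rabs (dens q beta k x y - marg q beta k y))) by easy.
    rewrite <- intS_scal.
    - f_equal. apply functional_extensionality. intros y. apply marg_tv.
    - apply (bounded_lip2_int1 (list_dist N) (fun y x => Rabs (dens q beta k x y - marg q beta k
      y))); auto with bl.
      apply (bounded_lip2_sym dR (list_dist N)); auto with bl. }
  rewrite E. set (N := (q ^ S k)%nat) in *.
  pose proof (bounded_lip2_dens_dev k) as HA. fold N in HA.
  pose proof (fun x => bounded_lip2_r dR (list_dist N) _ x (nneg_dl N) (dR_refl x) HA) as HA1.
  simpl in HA1.
  assert (HI : bounded_lip dR (fun x => intS N (fun y => Rabs (dens q beta k x y - marg q beta k y))))
    by (apply (bounded_lip2_intS N dR (fun x y => Rabs (dens q beta k x y - marg q beta k y)));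
      auto with bl).
  set (B := C * INR q * (INR q * lam) ^ k).
  assert (HB : 0 <= B).
  { unfold B. pose proof (pos_INR q). apply Rmult_le_pos; [nra|]. apply pow_le; nra. }
  split.
  - apply Rmult_le_pos; [lra|]. rewrite <- (int1_const 0). apply int1_le; auto using cts_const with bl.
    intros x _. rewrite <- (intS_const N 0). apply intS_le; auto with bl. intros; apply Rabs_pos.
  - enough (int1 (fun x => intS N (fun y => Rabs (dens q beta k x y - marg q beta k y))) <= B) by lra.
    rewrite <- (int1_const B). apply int1_le; auto using cts_const with bl.
    intros x _. apply le_epsilon. intros e He. now apply dual_bound.
Qed.

Lemma exp_tv_lim : 0 <= C -> 0 <= lam -> INR q * lam < 1 -> is_lim_seq (exp_tv q beta) 0.
Proof.
  (* Depth 0 is a separate case of [exp_tv]; the bound concerns depth [k + 1]. *)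
  intros HC Hlam Hq. apply is_lim_seq_incr_1.
  apply is_lim_seq_le_le with (fun _ => 0) (fun k => C * INR q * (INR q * lam) ^ k).
  - intros k. now apply exp_tv_bound.
  - apply is_lim_seq_const.
  - replace (Finite 0) with (Rbar_mult (C * INR q) 0) by (simpl; now rewrite Rmult_0_r).
    apply is_lim_seq_scal_l, is_lim_seq_geom.
    pose proof (pos_INR q). rewrite Rabs_right; nra.
Qed.

End Tree.

(** * The heat equation *)

(** One-sided because a space-time minimum may be attained at the final time, where only earlier
    times can be compared. *)
Lemma left_min_derive (f : R -> R) a t l : a < t -> is_derive f t l ->
  (forall s, a < s < t -> f t <= f s) -> l <= 0.
Proof.
  intros Hat Hd Hm. destruct (Rle_dec l 0) as [|Hl]; [easy|exfalso].
  apply is_derive_Reals in Hd. destruct (Hd l) as [dlt Hdl]; [lra|].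
  set (h := - Rmin (dlt / 2) ((t - a) / 2)).
  assert (Hh : 0 < Rmin (dlt / 2) ((t - a) / 2)).
  { apply Rmin_glb_lt; [|lra]. destruct dlt; simpl; lra. }
  assert (h < 0) by (unfold h; lra).
  assert (- h <= dlt / 2) by (unfold h; rewrite Ropp_involutive; apply Rmin_l).
  assert (- h <= (t - a) / 2) by (unfold h; rewrite Ropp_involutive; apply Rmin_r).
  assert (0 < dlt) by (destruct dlt; simpl; lra).
  specialize (Hdl h ltac:(lra)). rewrite Rabs_left in Hdl by lra. specialize (Hdl ltac:(lra)).
  apply Rabs_def2 in Hdl. specialize (Hm (t + h) ltac:(lra)).
  assert ((f (t + h) - f t) / h <= 0).
  { apply (Rmult_le_reg_r (- h)); [lra|]. unfold Rdiv.
    replace ((f (t + h) - f t) * / h * - h) with (- (f (t + h) - f t)) by (field; lra). lra. }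
  lra.
Qed.

Lemma right_min_derive (f : R -> R) b t l : t < b -> is_derive f t l ->
  (forall s, t < s < b -> f t <= f s) -> 0 <= l.
Proof.
  intros Hat Hd Hm.
  enough (- l <= 0) by lra.
  apply (left_min_derive (fun s => f (- s)) (- b) (- t)); [lra| |].
  - evar_last.
    + apply (is_derive_comp f (fun s => - s)).
      * rewrite Ropp_involutive. exact Hd.
      * instantiate (1 := -1). auto_derive; [easy|ring].
    + unfold scal; simpl; unfold mult; simpl. ring.
  - intros s Hs. rewrite Ropp_involutive. apply Hm. lra.
Qed.

(** The one-sided lemmas give [f1 z = 0]. If [l] were negative, [f1] would be negative just to the
    right of [z] and [f] would drop below [f z] there. *)
Lemma second_derive_min (f f1 : R -> R) a b z l : a < z < b ->
  (forall y, is_derive f y (f1 y)) -> is_derive f1 z l ->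
  (forall y, a < y < b -> f z <= f y) -> 0 <= l.
Proof.
  intros Hz Hf Hf1 Hm.
  assert (E : f1 z = 0).
  { apply Rle_antisym.
    - apply (left_min_derive f a z); [lra|auto|intros; apply Hm; lra].
    - apply (right_min_derive f b z); [lra|auto|intros; apply Hm; lra]. }
  destruct (Rle_dec 0 l) as [|Hl]; [easy|exfalso].
  apply is_derive_Reals in Hf1. destruct (Hf1 (- l)) as [dlt Hdl]; [lra|].
  assert (0 < dlt) by (destruct dlt; simpl; lra).
  set (h := Rmin (dlt / 2) ((b - z) / 2)).
  assert (0 < h) by (apply Rmin_glb_lt; lra).
  assert (h <= dlt / 2) by apply Rmin_l. assert (h <= (b - z) / 2) by apply Rmin_r.
  destruct (MVT_cor2 f f1 z (z + h)) as (c & Hv & Hc); [lra|intros; apply is_derive_Reals, Hf|].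
  pose proof (Hm (z + h) ltac:(lra)) as Hm'.
  assert (Hneg : f1 c < 0).
  { specialize (Hdl (c - z) ltac:(lra)). rewrite Rabs_right in Hdl by lra. specialize (Hdl ltac:(lra)).
    apply Rabs_def2 in Hdl. replace (z + (c - z)) with c in Hdl by ring. rewrite E, Rminus_0_r in Hdl.
    apply Rnot_le_lt. intros Hge.
    assert (0 <= f1 c / (c - z)) by (apply Rdiv_le_0_compat; lra). lra. }
  nra.
Qed.

(** Compactness of the rectangle in two one-dimensional steps: a minimiser [Z t] is chosen on each
    slice, then the slice minimum is minimised in [t]. Uniform continuity of [w] makes the slice
    minimum continuous. *)
Lemma min_2d (w : R -> R -> R) (a b c d : R) : 0 < a -> a <= b -> c <= d ->
  (forall t z, 0 < t -> continuity_2d_pt w t z) ->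
  exists t z, a <= t <= b /\ c <= z <= d /\ forall t' z', a <= t' <= b -> c <= z' <= d ->
    w t z <= w t' z'.
Proof.
  intros Ha Hab Hcd Hw.
  (* The condition [0 < t] sits under the existential so that the choice function is defined for
     every real [t]. *)
  assert (HZ : forall t, exists z, 0 < t -> c <= z <= d /\ forall z', c <= z' <= d -> w t z <= w t z').
  { intros t. destruct (Rlt_dec 0 t) as [Ht|Ht]; [|exists 0; lra].
    destruct (continuity_ab_min (w t) c d Hcd) as (z & H1 & H2).
    - intros y _. specialize (Hw t y Ht). intros e He. destruct (Hw (mkposreal e He)) as [dlt Hdl].
      exists dlt. split; [destruct dlt; simpl; lra|]. intros y' [_ Hy']. simpl in *. unfold R_dist in *.
      apply Hdl; [|easy]. rewrite Rminus_diag, Rabs_R0. destruct dlt; simpl; lra.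
    - exists z. intros _. split; auto. }
  set (Z := fun t => proj1_sig (constructive_indefinite_description _ (HZ t))).
  assert (Hz : forall t, 0 < t -> c <= Z t <= d /\ forall z', c <= z' <= d -> w t (Z t) <= w t z').
  { intros t. unfold Z. destruct (constructive_indefinite_description _ (HZ t)) as [z H]. exact H. }
  destruct (continuity_ab_min (fun t => w t (Z t)) a b Hab) as (t & H1 & H2).
  - intros t Ht e He.
    (* Continuity at [t] is two-sided, so nearby times may leave [a, b]; the lower limit [a / 2]
       keeps them positive. *)
    destruct (uniform_continuity_2d w (a / 2) (b + 1) c d) with (eps := mkposreal e He) as [dlt Hdl].
    { intros x y Hx Hy. apply Hw. lra. }
    assert (Hdp : 0 < dlt) by (destruct dlt; simpl; lra).
    assert (Hm : 0 < Rmin dlt (Rmin (a / 2) 1)) by (apply Rmin_glb_lt; [|apply Rmin_glb_lt]; lra).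
    exists (Rmin dlt (Rmin (a / 2) 1)). split; [easy|]. intros s [_ Hs]. simpl in *. unfold R_dist in *.
    assert (Hs1 : Rabs (s - t) < dlt) by (eapply Rlt_le_trans; [exact Hs|apply Rmin_l]).
    assert (Hs2 : Rabs (s - t) < a / 2).
    { eapply Rlt_le_trans; [exact Hs|]. apply Rle_trans with (Rmin (a/2) 1);
      [apply Rmin_r|apply Rmin_l]. }
    assert (Hs3 : Rabs (s - t) < 1).
    { eapply Rlt_le_trans; [exact Hs|]. apply Rle_trans with (Rmin (a/2) 1); apply Rmin_r. }
    apply Rabs_def2 in Hs2. apply Rabs_def2 in Hs3.
    destruct (Hz t ltac:(lra)) as [Zt Mt]. destruct (Hz s ltac:(lra)) as [Zs Ms].
    assert (U : forall z, c <= z <= d -> Rabs (w s z - w t z) < e).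
    { intros z Hzz. apply (Hdl t z s z); try lra; try easy. rewrite Rminus_diag, Rabs_R0. easy. }
    pose proof (U (Z t) Zt) as U1. pose proof (U (Z s) Zs) as U2.
    apply Rabs_def2 in U1. apply Rabs_def2 in U2. specialize (Mt (Z s) Zs). specialize (Ms (Z t) Zt).
    apply Rabs_def1; lra.
  - exists t, (Z t). destruct (Hz t ltac:(lra)) as [Zt Mt]. split; [easy|]. split; [easy|].
    intros t' z' Ht' Hz'. destruct (Hz t' ltac:(lra)) as [Zt' Mt'].
    specialize (H1 t' Ht'). specialize (Mt' z' Hz'). simpl in H1. lra.
Qed.

(* The fields are the witnesses [u_z] and [u_zz] of [u_t = u_zz / 2]. *)
Definition heat (u : R -> R -> R) : Prop :=
  exists uz uzz : R -> R -> R, forall t z, 0 < t ->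
    is_derive (fun s => u s z) t (uzz t z / 2) /\ is_derive (u t) z (uz t z) /\
    is_derive (uz t) z (uzz t z) /\ continuity_2d_pt u t z.

(** The initial time [t0] is positive, away from the singularity of the Gaussian at time 0. An
    interior minimum of [u] alone would give no contradiction, so a small multiple of time is
    added. *)
Lemma heat_min_principle u t0 T c d eta z : heat u -> 0 < t0 < T -> c <= z <= d ->
  (forall y, c <= y <= d -> - eta <= u t0 y) ->
  (forall t, 0 < t -> - eta <= u t c) -> (forall t, 0 < t -> - eta <= u t d) -> - eta <= u T z.
Proof.
  intros (uz & uzz & Hu) Ht Hz H0 Hc Hd.
  destruct (Rle_dec (- eta) (u T z)) as [|Hn]; [easy|exfalso].
  (* The slope for which the added term uses up half of the gap at time [T]. The minimum of [w]
     stays below [- eta], hence off the initial line and the sides, and there [uzz / 2 + e <= 0]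
     contradicts [0 <= uzz]. *)
  set (e := (- eta - u T z) / (2 * (T - t0))).
  assert (He : 0 < e) by (apply Rdiv_lt_0_compat; lra).
  assert (HeT : e * (T - t0) = (- eta - u T z) / 2) by (unfold e; field; lra).
  set (w := fun t y => u t y + e * (t - t0)).
  destruct (min_2d w t0 T c d) as (t & y & Hty & Hy & Hmin); try lra.
  { intros s x Hs. apply continuity_2d_pt_plus; [now apply Hu|].
    apply (continuity_2d_pt_mult (fun _ _ => e) (fun s _ => s - t0)).
    - apply continuity_2d_pt_const.
    - apply (continuity_2d_pt_minus (fun s _ => s) (fun _ _ => t0));
      [apply continuity_2d_pt_id1|apply continuity_2d_pt_const]. }
  pose proof (Hmin T z ltac:(lra) Hz) as HT. unfold w in HT. rewrite HeT in HT.
  assert (Hw : u t y + e * (t - t0) < - eta) by lra.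
  assert (He' : 0 <= e * (t - t0)) by (apply Rmult_le_pos; lra).
  assert (t <> t0) by (intros ->; specialize (H0 y Hy); lra).
  assert (y <> c) by (intros ->; specialize (Hc t ltac:(lra)); lra).
  assert (y <> d) by (intros ->; specialize (Hd t ltac:(lra)); lra).
  destruct (Hu t y ltac:(lra)) as (D1 & _ & D3 & _).
  assert (0 <= uzz t y).
  { apply (second_derive_min (u t) (uz t) c d y); [lra| |easy|].
    - intros x. now apply (Hu t x ltac:(lra)).
    - intros x Hx. specialize (Hmin t x Hty ltac:(lra)). unfold w in Hmin. lra. }
  assert (uzz t y / 2 + e <= 0).
  { apply (left_min_derive (fun s => w s y) t0 t); [lra| |].
    - unfold w. apply (is_derive_plus (fun s => u s y) (fun s => e * (s - t0))); [easy|].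
      auto_derive; [easy|ring].
    - intros s Hs. apply Hmin; lra. }
  lra.
Qed.

Lemma heat_plus u v : heat u -> heat v -> heat (fun t z => u t z + v t z).
Proof.
  intros (uz & uzz & Hu) (vz & vzz & Hv).
  exists (fun t z => uz t z + vz t z), (fun t z => uzz t z + vzz t z). intros t z Ht.
  destruct (Hu t z Ht) as (U1 & U2 & U3 & U4). destruct (Hv t z Ht) as (V1 & V2 & V3 & V4).
  split; [|split; [|split]].
  - replace ((uzz t z + vzz t z) / 2) with (uzz t z / 2 + vzz t z / 2) by field.
    now apply (is_derive_plus (fun s => u s z) (fun s => v s z)).
  - now apply (is_derive_plus (u t) (v t)).
  - now apply (is_derive_plus (uz t) (vz t)).
  - now apply continuity_2d_pt_plus.
Qed.

Lemma heat_opp u : heat u -> heat (fun t z => - u t z).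
Proof.
  intros (uz & uzz & Hu).
  exists (fun t z => - uz t z), (fun t z => - uzz t z). intros t z Ht.
  destruct (Hu t z Ht) as (U1 & U2 & U3 & U4).
  split; [|split; [|split]].
  - replace (- uzz t z / 2) with (- (uzz t z / 2)) by field.
    now apply (is_derive_opp (fun s => u s z)).
  - now apply (is_derive_opp (u t)).
  - now apply (is_derive_opp (uz t)).
  - now apply continuity_2d_pt_opp.
Qed.

Lemma heat_sumN n (u : nat -> R -> R -> R) : (forall j, heat (u j)) ->
  heat (fun t z => sumN n (fun j => u j t z)).
Proof.
  revert u. induction n as [|n IH]; intros u H.
  - exists (fun _ _ => 0), (fun _ _ => 0). intros t z _. simpl. split; [|split; [|split]].
    + replace (0 / 2) with 0 by field. apply (is_derive_const (V := R_NormedModule)).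
    + apply (is_derive_const (V := R_NormedModule)).
    + apply (is_derive_const (V := R_NormedModule)).
    + apply continuity_2d_pt_const.
  - apply (heat_plus (u O) (fun t z => sumN n (fun j => u (S j) t z))); auto.
Qed.

Lemma gauss_den_pos t : 0 < t -> 0 < sqrt (2 * PI * t).
Proof. intros Ht. apply sqrt_lt_R0. pose proof PI_RGT_0. nra. Qed.

Lemma gauss_pos t v : 0 < t -> 0 < gauss t v.
Proof. intros Ht. apply Rdiv_lt_0_compat; [apply exp_pos|now apply gauss_den_pos]. Qed.

Lemma gauss_derive t v : 0 < t -> is_derive (gauss t) v (- v / t * gauss t v).
Proof.
  intros Ht. pose proof (gauss_den_pos t Ht). unfold gauss. auto_derive; [easy|]. 
  unfold Rdiv. simpl. field. split; lra.
Qed.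

(** The condition on [s] covers translates and reflections at once, since the chain rule contributes
    [s * s] to the second derivative. *)
Lemma heat_gauss c s : s * s = 1 -> heat (fun t z => gauss t (c + s * z)).
Proof.
  intros Hs.
  exists (fun t z => s * (- (c + s * z) / t * gauss t (c + s * z))),
         (fun t z => ((c + s * z) ^ 2 / t ^ 2 - / t) * gauss t (c + s * z)).
  intros t z Ht. pose proof (gauss_den_pos t Ht) as Hd. pose proof PI_RGT_0 as HP.
  assert (HD : forall y, is_derive (fun z => gauss t (c + s * z)) y (s * (- (c + s * y) / t * gauss t
    (c + s * y)))).
  { intros y. apply (is_derive_comp (gauss t) (fun z => c + s * z)); [now apply gauss_derive|].
    auto_derive; [easy|ring]. }
  split; [|split; [|split]].
  - set (v := c + s * z). unfold gauss. auto_derive.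
    + repeat split; try lra. nra.
    + change (v * (v * 1)) with (v ^ 2).
      assert (E : sqrt (2 * PI * t) * sqrt (2 * PI * t) = 2 * PI * t) by (apply sqrt_sqrt; nra).
      set (S := sqrt (2 * PI * t)) in *. 
      (* Eliminating [PI] in favour of the square root leaves an identity of rational functions. *)
      replace PI with (S * S / (2 * t)) by (rewrite E; field; lra).
      replace (- v ^ 2 / (2 * t)) with (- v ^ 2 * / (2 * t)) by reflexivity.
      field. split; lra.
  - apply HD.
  - evar_last.
    + apply (is_derive_scal (fun y => - (c + s * y) / t * gauss t (c + s * y))).
      apply (is_derive_mult (fun y => - (c + s * y) / t) (fun y => gauss t (c + s * y)));
        [|apply HD|intros; apply Rmult_comm].
      instantiate (1 := - s / t). auto_derive; [lra|field; lra].
    + unfold plus, mult, scal; simpl; unfold mult; simpl.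
      replace (s * (- s / t * gauss t (c + s * z) + - (c + s * z) / t * (s * (- (c + s * z) / t *
        gauss t (c + s * z)))))
       with ((s * s) * ((- / t + (c + s * z) ^ 2 / t ^ 2) * gauss t (c + s * z))) by (field; lra).
      rewrite Hs. simpl. ring.
  - assert (C1 : continuity_2d_pt (fun t z => - (c + s * z) ^ 2 * / (2 * t)) t z).
    { assert (C : continuity_2d_pt (fun _ z => c + s * z) t z)
        by (apply (continuity_1d_2d_pt_comp (fun z => c + s * z) (fun _ z => z));
          [reg|apply continuity_2d_pt_id2]).
      apply (continuity_2d_pt_mult (fun _ z => - (c + s * z) ^ 2) (fun t _ => / (2 * t))).
      - apply (continuity_1d_2d_pt_comp (fun v => - v ^ 2) (fun _ z => c + s * z)); [reg|easy].
      - apply (continuity_1d_2d_pt_comp (fun t => / (2 * t)) (fun t _ => t)); [reg;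
        lra|apply continuity_2d_pt_id1]. }
    apply (continuity_2d_pt_mult (fun t z => exp (- (c + s * z) ^ 2 * / (2 * t))) (fun t _ => / sqrt
      (2 * PI * t))).
    + apply (continuity_1d_2d_pt_comp exp (fun t z => - (c + s * z) ^ 2 * / (2 * t))); [reg|easy].
    + apply (continuity_1d_2d_pt_comp (fun t => / sqrt (2 * PI * t)) (fun t _ => t));
      [|apply continuity_2d_pt_id1].
      apply continuity_pt_filterlim. apply (ex_derive_continuous (fun t => / sqrt (2 * PI * t))).
      auto_derive. repeat split; try lra. nra.
Qed.

(** * The Gaussian integral *)

Lemma exp_le_mono x y : x <= y -> exp x <= exp y.
Proof. intros [H| ->]; [left; now apply exp_increasing|right; easy]. Qed.

Definition erf0 (x : R) : R := RInt (fun t => exp (- t ^ 2)) 0 x.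

Lemma cts_derivable (f : R -> R) : (forall x, ex_derive f x) -> cts f.
Proof. intros H x. apply (ex_derive_continuous f), H. Qed.

Lemma cts_gauss0 : cts (fun t => exp (- t ^ 2)).
Proof. apply cts_derivable. intros x. auto_derive. easy. Qed.

Lemma erf0_derive x : is_derive erf0 x (exp (- x ^ 2)).
Proof.
  apply (is_derive_RInt (fun t => exp (- t ^ 2)) erf0 0 x).
  - exists (mkposreal 1 Rlt_0_1). intros y _. apply (RInt_correct (V := R_CompleteNormedModule)).
    apply cts_ex_RInt, cts_gauss0.
  - apply cts_gauss0.
Qed.

(* The parametric integral completes [erf0 x ^ 2] to the constant [PI / 4]. *)
Lemma gauss_aux_derive x :
  is_derive (fun x => RInt (fun t => exp (- x ^ 2 * (1 + t ^ 2)) / (1 + t ^ 2)) 0 1) x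
    (- 2 * exp (- x ^ 2) * erf0 x).
Proof.
  assert (Hp : forall t : R, 0 < 1 + t ^ 2) by (intros t; nra).
  set (f := fun x t : R => exp (- x ^ 2 * (1 + t ^ 2)) / (1 + t ^ 2)).
  assert (D : forall x t, is_derive (fun u => f u t) x (- 2 * x * exp (- x ^ 2 * (1 + t ^ 2)))).
  { intros y t. unfold f. specialize (Hp t). auto_derive; [lra|]. simpl. field. lra. }
  evar_last.
  - apply (is_derive_RInt_param f 0 1 x).
    + exists (mkposreal 1 Rlt_0_1). intros y _ t _. eexists; apply D.
    + intros t _. apply (continuity_2d_pt_ext (fun y t => - 2 * y * exp (- y ^ 2 * (1 + t ^ 2)))).
      { intros y s. symmetry. apply is_derive_unique, D. }
      apply (continuity_2d_pt_mult (fun y _ => - 2 * y) (fun y t => exp (- y ^ 2 * (1 + t ^ 2)))).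
      * apply (continuity_1d_2d_pt_comp (fun y => - 2 * y) (fun y _ => y));
        [reg|apply continuity_2d_pt_id1].
      * apply (continuity_1d_2d_pt_comp exp (fun y t => - y ^ 2 * (1 + t ^ 2))); [reg|].
        apply (continuity_2d_pt_mult (fun y _ => - y ^ 2) (fun _ t => 1 + t ^ 2)).
        -- apply (continuity_1d_2d_pt_comp (fun y => - y ^ 2) (fun y _ => y));
          [reg|apply continuity_2d_pt_id1].
        -- apply (continuity_1d_2d_pt_comp (fun y => 1 + y ^ 2) (fun _ y => y));
          [reg|apply continuity_2d_pt_id2].
    + exists (mkposreal 1 Rlt_0_1). intros y _. apply cts_ex_RInt, cts_derivable. intros t.
      unfold f. specialize (Hp t). auto_derive. simpl in Hp. lra.
  (* Prepares the substitution [x * t] for the variable of [erf0]; the [+ 0] is the affine form of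
     [RInt_comp_lin]. *)
  - rewrite (RInt_ext _ (fun t => (- 2 * exp (- x ^ 2)) * (x * exp (- (x * t + 0) ^ 2)))).
    + rewrite (RInt_scal (V := R_CompleteNormedModule) (fun t => x * exp (- (x * t + 0) ^ 2))).
      * pose proof (RInt_comp_lin (V := R_CompleteNormedModule) (fun t => exp (- t ^ 2)) x 0 0 1) as HL.
        unfold scal in *; simpl in *; unfold mult in *; simpl in *.
        rewrite HL by apply cts_ex_RInt, cts_gauss0.
        unfold erf0. simpl. f_equal. f_equal; ring.
      * apply cts_ex_RInt, cts_derivable. intros t. auto_derive. easy.
    + intros t _. transitivity (- 2 * x * exp (- x ^ 2 * (1 + t ^ 2))); [apply is_derive_unique, D|].
      replace (- x ^ 2 * (1 + t ^ 2)) with (- x ^ 2 + - (x * t + 0) ^ 2) by ring. rewrite exp_plus.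
      match goal with |- _ = ?b => change (@eq R (- 2 * x * (exp (- x ^ 2) * exp (- (x * t + 0) ^
        2))) b) end. ring.
Qed.

(** The derivatives of [erf0 ^ 2] and of the parametric integral [B] cancel. Their sum keeps its
    value at 0, which is [atan 1], and [B x] lies between 0 and [exp (- x ^ 2)]. *)
Lemma erf0_sqr x : 0 <= x -> Rabs (erf0 x ^ 2 - PI / 4) <= exp (- x ^ 2).
Proof.
  intros Hx. set (B := fun x => RInt (fun t => exp (- x ^ 2 * (1 + t ^ 2)) / (1 + t ^ 2)) 0 1).
  assert (Hp : forall t : R, 0 < 1 + t ^ 2) by (intros t; nra).
  assert (D : forall y, is_derive (fun y => erf0 y ^ 2 + B y) y 0).
  { intros y. evar_last.
    - apply (is_derive_plus (fun y => erf0 y ^ 2) B); [|apply gauss_aux_derive].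
      apply is_derive_pow, erf0_derive.
    - unfold plus; simpl. ring. }
  assert (E : erf0 x ^ 2 + B x = erf0 0 ^ 2 + B 0).
  { destruct (MVT_gen (fun y => erf0 y ^ 2 + B y) 0 x (fun _ => 0)) as (c & _ & Hc).
    - intros; apply D.
    - intros y _. apply continuity_pt_filterlim. apply (ex_derive_continuous (fun y => erf0 y ^ 2 + B
      y)).
      eexists; apply D.
    - lra. }
  assert (B0 : B 0 = PI / 4).
  { unfold B. rewrite (RInt_ext _ (fun t => / (1 + t ^ 2))).
    - apply is_RInt_unique. replace (PI / 4) with (minus (atan 1) (atan 0)).
      + apply (is_RInt_derive atan).
        * intros t _. evar_last; [apply is_derive_atan|]. unfold Rsqr. f_equal. ring.
        * intros t _. apply (cts_derivable (fun t => / (1 + t ^ 2))). intros s. specialize (Hp s).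
        auto_derive. simpl in Hp. lra.
      + unfold minus, plus, opp; simpl. rewrite atan_0, atan_1. ring.
    - intros t _. replace (- 0 ^ 2 * (1 + t ^ 2)) with 0 by ring. rewrite exp_0.
    change (@eq R (1 / (1 + t ^ 2)) (/ (1 + t ^ 2))). field. specialize (Hp t). lra. }
  assert (E0 : erf0 0 = 0) by (unfold erf0; apply (RInt_point (V := R_CompleteNormedModule))).
  rewrite E0, B0 in E. replace (erf0 x ^ 2 - PI / 4) with (- B x) by lra. rewrite Rabs_Ropp.
  replace (exp (- x ^ 2)) with ((1 - 0) * exp (- x ^ 2)) by ring. apply abs_RInt_le_const; [lra| |].
  - apply cts_ex_RInt, cts_derivable. intros t. specialize (Hp t). auto_derive. simpl in Hp. lra.
  - intros t _. specialize (Hp t). pose proof (exp_pos (- x ^ 2 * (1 + t ^ 2))).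
    rewrite Rabs_right by (apply Rle_ge, Rlt_le, Rdiv_lt_0_compat; lra).
    apply Rle_trans with (exp (- x ^ 2 * (1 + t ^ 2))).
    + apply (Rmult_le_reg_r (1 + t ^ 2)); [easy|]. unfold Rdiv. rewrite Rmult_assoc, Rinv_l by lra. nra.
    + apply exp_le_mono. nra.
Qed.

Lemma exp_neg_le_inv x : 0 < x -> exp (- x) <= / x.
Proof.
  intros Hx. rewrite exp_Ropp. apply Rinv_le_contravar; [easy|]. pose proof (exp_ineq1_le x). lra.
Qed.

Lemma erf0_pos x : 0 <= x -> 0 <= erf0 x.
Proof.
  intros Hx. unfold erf0. apply RInt_ge_0; [easy|apply cts_ex_RInt, cts_gauss0|].
  intros; apply Rlt_le, exp_pos.
Qed.

Lemma erf0_lim (a : nat -> R) : is_lim_seq a p_infty -> is_lim_seq (fun n => erf0 (a n)) (sqrt PI / 2).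
Proof.
  intros Ha. assert (HP : 0 < sqrt PI) by (apply sqrt_lt_R0, PI_RGT_0).
  apply is_lim_seq_spec. intros e. apply is_lim_seq_spec in Ha.
  assert (He : 0 < e * (sqrt PI / 2)) by (apply Rmult_lt_0_compat; [apply cond_pos|lra]).
  (* The 1 ensures [x < x ^ 2]; the other term makes [exp (- x ^ 2) <= / x ^ 2] smaller than
     [e * (sqrt PI / 2)]. The factor [sqrt PI / 2] bounds [erf0 x + sqrt PI / 2] from below when the
     difference of squares is factored. *)
  destruct (Ha (1 + / (e * (sqrt PI / 2)))) as [N HN]. exists N. intros n Hn. specialize (HN n Hn).
  simpl in HN.
  set (x := a n) in *. assert (Hi : 0 < / (e * (sqrt PI / 2))) by now apply Rinv_0_lt_compat.
  assert (Hx : 1 < x) by lra.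
  pose proof (erf0_sqr x ltac:(lra)) as H1. pose proof (erf0_pos x ltac:(lra)) as H2.
  assert (H3 : exp (- x ^ 2) < e * (sqrt PI / 2)).
  { apply Rle_lt_trans with (1 := exp_neg_le_inv (x ^ 2) ltac:(nra)).
    rewrite <- (Rinv_inv (e * (sqrt PI / 2))). assert (x < x ^ 2) by nra.
    apply Rinv_lt_contravar; [apply Rmult_lt_0_compat|]; lra. }
  assert (HS : PI / 4 = (sqrt PI / 2) ^ 2) by (rewrite <- (sqrt_sqrt PI) at 1
    by (pose proof PI_RGT_0; lra); field).
  rewrite HS in H1. replace (erf0 x ^ 2 - (sqrt PI / 2) ^ 2) with ((erf0 x - sqrt PI / 2) * (erf0 x +
    sqrt PI / 2)) in H1 by ring.
  rewrite Rabs_mult, (Rabs_right (erf0 x + _)) in H1 by lra.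
  apply (Rmult_lt_reg_r (sqrt PI / 2)); [lra|].
  pose proof (Rabs_pos (erf0 x - sqrt PI / 2)). nra.
Qed.

Lemma cts_gauss beta : 0 < beta -> cts (gauss beta).
Proof. intros Hb. apply cts_derivable. intros x. eexists. now apply gauss_derive. Qed.

Lemma gauss_half_integral beta (a : nat -> R) : 0 < beta -> is_lim_seq a p_infty ->
  is_lim_seq (fun n => RInt (gauss beta) 0 (a n)) (1 / 2).
Proof.
  intros Hb Ha. set (s := sqrt (2 * beta)).
  assert (Hs : 0 < s) by (apply sqrt_lt_R0; lra).
  assert (Hss : s * s = 2 * beta) by (apply sqrt_sqrt; lra).
  assert (HP : 0 < sqrt PI) by (apply sqrt_lt_R0, PI_RGT_0).
  apply (is_lim_seq_ext (fun n => / sqrt PI * erf0 (a n * / s))).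
  - intros n. unfold erf0.
    pose proof (RInt_comp_lin (V := R_CompleteNormedModule) (fun t => exp (- t ^ 2)) (/ s) 0 0 (a n))
      as HL.
    replace (/ s * 0 + 0) with 0 in HL by ring. replace (/ s * a n + 0) with (a n * / s) in HL by ring.
    rewrite <- HL by apply cts_ex_RInt, cts_gauss0.
    transitivity (RInt (fun y => / sqrt PI * (/ s * exp (- (/ s * y + 0) ^ 2))) 0 (a n)).
    { symmetry. apply (RInt_scal (V := R_CompleteNormedModule) (fun y => / s * exp (- (/ s * y + 0) ^
      2))).
      apply cts_ex_RInt, cts_derivable. intros t. auto_derive. easy. }
    apply RInt_ext. intros t _. unfold gauss.
    replace (2 * PI * beta) with (PI * (2 * beta)) by ring.
    rewrite sqrt_mult_alt by (pose proof PI_RGT_0; lra).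
    fold s. rewrite <- Hss.
    replace (- (/ s * t + 0) ^ 2) with (- t ^ 2 / (s * s)) by (field; lra).
    match goal with |- ?a = ?b => change (@eq R a b) end. field. split; lra.
  - replace (Finite (1 / 2)) with (Rbar_mult (/ sqrt PI) (sqrt PI / 2)) by (simpl; f_equal; field; lra).
    apply is_lim_seq_scal_l, erf0_lim.
    replace p_infty with (Rbar_mult p_infty (/ s)).
    + now apply is_lim_seq_scal_r.
    + simpl. assert (Hi : 0 < / s) by now apply Rinv_0_lt_compat.
      destruct (Rle_dec 0 (/ s)) as [H|H]; [|lra]. destruct (Rle_lt_or_eq_dec 0 (/ s) H); [easy|lra].
Qed.

(** * The wrapped Gaussian *)

Lemma gauss_even t v : gauss t (- v) = gauss t v.
Proof. unfold gauss. now replace ((- v) ^ 2) with (v ^ 2) by ring. Qed.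

Lemma gauss_le t v w : 0 < t -> Rabs v <= Rabs w -> gauss t w <= gauss t v.
Proof.
  intros Ht H. pose proof (gauss_den_pos t Ht). unfold gauss.
  apply Rmult_le_compat_r; [apply Rlt_le, Rinv_0_lt_compat; lra|]. apply exp_le_mono.
  apply Rmult_le_compat_r; [apply Rlt_le, Rinv_0_lt_compat; lra|].
  apply Ropp_le_contravar. apply pow_maj_Rabs with (n := 2%nat) in H.
  rewrite <- (Rabs_right (w ^ 2)) by nra. rewrite <- RPow_abs. exact H.
Qed.

Lemma heat_gauss_affine c s (e : R -> R) : s * s = 1 -> (forall z, e z = c + s * z) ->
  heat (fun t z => gauss t (e z)).
Proof.
  intros Hs He. replace (fun t z => gauss t (e z)) with (fun t z => gauss t (c + s * z)).
  - now apply heat_gauss.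
  - apply functional_extensionality; intros t; apply functional_extensionality; intros z.
  now rewrite He.
Qed.

(* Truncation of the wrapped density to the translates by [2 PI m], [|m| <= M], with the
   negative [m] reflected by evenness. *)
Definition wrapN (t : R) (M : nat) (v : R) : R :=
  sumN (S M) (fun j => gauss t (v + 2 * PI * INR j)) + sumN M (fun j => gauss t (2 * PI - v + 2 * PI
    * INR j)).

Lemma heat_wrapN M c s (e : R -> R) : s * s = 1 -> (forall z, e z = c + s * z) ->
  heat (fun t z => wrapN t M (e z)).
Proof.
  intros Hs He. apply (heat_plus (fun t z => sumN (S M) (fun j => gauss t (e z + 2 * PI * INR j)))
                   (fun t z => sumN M (fun j => gauss t (2 * PI - e z + 2 * PI * INR j)))).
  - apply (heat_sumN (S M) (fun j t z => gauss t (e z + 2 * PI * INR j))). intros j.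
    apply (heat_gauss_affine (c + 2 * PI * INR j) s); trivial. intros z. rewrite He. ring.
  - apply (heat_sumN M (fun j t z => gauss t (2 * PI - e z + 2 * PI * INR j))). intros j.
    apply (heat_gauss_affine (2 * PI - c + 2 * PI * INR j) (- s)); [lra|]. intros z. rewrite He. ring.
Qed.

Lemma sumN_minus n f g : sumN n f - sumN n g = sumN n (fun j => f j - g j).
Proof. revert f g. induction n as [|n IH]; intros f g; simpl; [ring|]. rewrite <- IH. ring. Qed.

Lemma sumN_telescope n (a : nat -> R) : sumN n (fun j => a j - a (S j)) = a O - a n.
Proof. revert a. induction n as [|n IH]; intros a; simpl; [ring|]. rewrite (IH (fun j => a (S j))).
ring. Qed.

(** The two arguments agree modulo [2 * PI], so the sums telescope to [b M - a (S M)], and the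
    argument in [b M] is the one nearer to 0. *)
Lemma wrapN_pi t M x : 0 < t -> 0 <= x <= PI -> 0 <= wrapN t M (x - PI) - wrapN t M (x + PI).
Proof.
  intros Ht Hx. pose proof PI_RGT_0 as HP. unfold wrapN.
  set (a := fun j => gauss t (x - PI + 2 * PI * INR j)).
  set (b := fun j => gauss t (PI - x + 2 * PI * INR j)).
  rewrite (sumN_ext (S M) (fun j => gauss t (x + PI + 2 * PI * INR j)) (fun j => a (S j)))
    by (intros j _; unfold a; rewrite S_INR; f_equal; ring).
  rewrite (sumN_ext M (fun j => gauss t (2 * PI - (x - PI) + 2 * PI * INR j)) (fun j => b (S j)))
    by (intros j _; unfold b; rewrite S_INR; f_equal; ring).
  rewrite (sumN_ext M (fun j => gauss t (2 * PI - (x + PI) + 2 * PI * INR j)) b)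
    by (intros j _; unfold b; f_equal; ring).
  fold a. pose proof (sumN_telescope (S M) a) as Ta. pose proof (sumN_telescope M b) as Tb.
  rewrite <- sumN_minus in Ta, Tb.
  assert (E : a O = b O). { unfold a, b. simpl INR. rewrite <- gauss_even. f_equal. ring. }
  assert (L : a (S M) <= b M).
  { unfold a, b. rewrite S_INR. pose proof (pos_INR M).
  assert (0 <= 2 * PI * INR M) by (apply Rmult_le_pos; lra).
    apply gauss_le; [easy|]. rewrite !Rabs_right; lra. }
  change (fun j => b j) with b in *. change (fun j => a j) with a in *. lra.
Qed.

(** The term [gauss t (x - z)] dominates both [gauss t (x + z)] and [gauss t (2 * PI - (x + z))].
    One of these two has argument at least [PI], so it is paid by [gauss t PI] and the other by the
    dominant term. The remaining [2 * M + 1] terms also have arguments beyond [PI]. *)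
Lemma wrapN_small t M x z : 0 < t -> 0 <= x <= PI -> 0 <= z <= PI ->
  - (2 * INR (S M) * gauss t PI) <= wrapN t (S M) (x - z) - wrapN t (S M) (x + z).
Proof.
  intros Ht Hx Hz. pose proof PI_RGT_0 as HP. unfold wrapN.
  assert (Hpos : forall j, 0 <= 2 * PI * INR j) by (intros j; pose proof (pos_INR j);
    apply Rmult_le_pos; lra).
  assert (S1 : gauss t (x - z) <= sumN (S (S M)) (fun j => gauss t (x - z + 2 * PI * INR j))).
  { replace (x - z) with (x - z + 2 * PI * INR 0) at 1 by (simpl; ring).
    apply (sumN_term (S (S M)) (fun j => gauss t (x - z + 2 * PI * INR j))); [|lia].
    intros; now apply Rlt_le, gauss_pos. }
  assert (S2 : 0 <= sumN (S M) (fun j => gauss t (2 * PI - (x - z) + 2 * PI * INR j))).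
  { apply sumN_pos. intros; now apply Rlt_le, gauss_pos. }
  assert (S3 : sumN (S (S M)) (fun j => gauss t (x + z + 2 * PI * INR j)) <= gauss t (x + z) + INR (S
    M) * gauss t PI).
  { rewrite <- sumN_const. change (sumN (S (S M)) ?f) with (f O + sumN (S M) (fun j => f (S j))).
  cbv beta.
    apply Rplus_le_compat; [simpl INR; rewrite Rmult_0_r, Rplus_0_r; lra|].
    apply sumN_le. intros j _. apply gauss_le; [easy|]. rewrite S_INR. specialize (Hpos j).
    rewrite !Rabs_right; lra. }
  assert (S4 : sumN (S M) (fun j => gauss t (2 * PI - (x + z) + 2 * PI * INR j)) <=
               gauss t (2 * PI - (x + z)) + INR M * gauss t PI).
  { rewrite <- sumN_const. change (sumN (S M) ?f) with (f O + sumN M (fun j => f (S j))). cbv beta.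
    apply Rplus_le_compat; [simpl INR; rewrite Rmult_0_r, Rplus_0_r; lra|].
    apply sumN_le. intros j _. apply gauss_le; [easy|]. rewrite S_INR. specialize (Hpos j).
    rewrite !Rabs_right; lra. }
  assert (G1 : gauss t (x + z) <= gauss t (x - z)).
  { apply gauss_le; [easy|]. rewrite (Rabs_right (x + z)) by lra. apply Rabs_le. lra. }
  assert (G2 : gauss t (2 * PI - (x + z)) <= gauss t (x - z)).
  { apply gauss_le; [easy|]. rewrite (Rabs_right (2 * PI - (x + z))) by lra. apply Rabs_le. lra. }
  assert (G3 : gauss t (x + z) <= gauss t PI \/ gauss t (2 * PI - (x + z)) <= gauss t PI).
  { destruct (Rle_dec PI (x + z)); [left|right]; apply gauss_le; trivial; rewrite !Rabs_right; lra. }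
  rewrite S_INR in *. destruct G3; lra.
Qed.

Lemma gauss_PI_small eta T : 0 < eta -> 0 < T -> exists t, 0 < t < T /\ gauss t PI <= eta.
Proof.
  intros He HT. pose proof PI_RGT_0 as HP.
  (* The second bound makes the denominator [S] at most [eta]. The exponential is at most
     [2 * t / PI ^ 2 <= S * S], so the quotient is at most [S]. *)
  set (t := Rmin (T / 2) (eta ^ 2 / (2 * PI))).
  assert (H1 : 0 < eta ^ 2 / (2 * PI)) by (apply Rdiv_lt_0_compat; nra).
  assert (Ht : 0 < t) by (apply Rmin_glb_lt; lra).
  assert (t <= T / 2) by apply Rmin_l. assert (H2 : t <= eta ^ 2 / (2 * PI)) by apply Rmin_r.
  exists t. split; [lra|]. pose proof (gauss_den_pos t Ht) as Hd. unfold gauss.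
  set (S := sqrt (2 * PI * t)) in *.
  assert (HS : S * S = 2 * PI * t) by (apply sqrt_sqrt; nra).
  assert (HSe : S <= eta).
  { apply Rsqr_incr_0; [|lra|lra]. unfold Rsqr. rewrite HS.
    apply (Rmult_le_compat_l (2 * PI)) in H2; [|lra].
    replace (2 * PI * (eta ^ 2 / (2 * PI))) with (eta * eta) in H2 by (field; lra). exact H2. }
  apply Rle_trans with (2 := HSe).
  replace (- PI ^ 2 / (2 * t)) with (- (PI ^ 2 / (2 * t))) by (field; lra).
  assert (HX : 0 < PI ^ 2 / (2 * t)) by (apply Rdiv_lt_0_compat; nra).
  apply (Rmult_le_reg_r S); [easy|]. unfold Rdiv at 1. rewrite Rmult_assoc, Rinv_l, Rmult_1_r by lra.
  rewrite HS.
  apply Rle_trans with (1 := exp_neg_le_inv _ HX).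
  apply (Rmult_le_reg_r (PI ^ 2 / (2 * t))); [easy|]. rewrite Rinv_l by lra.
  replace (2 * PI * t * (PI ^ 2 / (2 * t))) with (PI ^ 3) by (field; lra).
  pose proof PI2_3_2. assert (1 <= PI) by lra. rewrite <- (pow1 3). apply pow_incr. lra.
Qed.

(* As functions of [(t, z)] both sides solve the heat equation; their difference vanishes at
   [z = 0], telescopes to a nonnegative value at [z = PI], and is negligible below zero for
   small [t]. *)
Lemma wrapN_reflection T M x z : 0 < T -> 0 <= x <= PI -> 0 <= z <= PI ->
  wrapN T (S M) (x + z) <= wrapN T (S M) (x - z).
Proof.
  intros HT Hx Hz. pose proof PI_RGT_0 as HP. apply le_epsilon. intros e He.
  assert (HM : 0 < 2 * INR (S M)) by (pose proof (lt_0_INR (S M) ltac:(lia)); lra).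
  destruct (gauss_PI_small (e / (2 * INR (S M))) T) as (t0 & Ht0 & Hg); trivial.
  { now apply Rdiv_lt_0_compat. }
  assert (Hge : 2 * INR (S M) * gauss t0 PI <= e).
  { apply (Rmult_le_compat_l (2 * INR (S M))) in Hg; [|lra].
    replace (2 * INR (S M) * (e / (2 * INR (S M)))) with e in Hg by (field; lra). exact Hg. }
  enough (- e <= wrapN T (S M) (x - z) + - wrapN T (S M) (x + z)) by lra.
  apply (heat_min_principle (fun t z => wrapN t (S M) (x - z) + - wrapN t (S M) (x + z)) t0 T 0 PI e
    z); trivial.
  - apply (heat_plus (fun t z => wrapN t (S M) (x - z)) (fun t z => - wrapN t (S M) (x + z))).
    + apply (heat_wrapN (S M) x (-1)); intros; ring.
    + apply heat_opp, (heat_wrapN (S M) x 1 (fun z => x + z)); intros; ring.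
  - intros y Hy. pose proof (wrapN_small t0 M x y ltac:(lra) Hx Hy). lra.
  - intros t Ht. rewrite Rminus_0_r, Rplus_0_r. lra.
  - intros t Ht. pose proof (wrapN_pi t (S M) x Ht Hx). lra.
Qed.

Section Wrapped.

Variable beta : R.
Hypothesis beta_pos : 0 < beta.

(* Evenness of the Gaussian turns the sum over negative translates into [half_wrap (2 PI - v)]. *)
Definition half_wrap (v : R) : R := Series (fun m => gauss beta (v + 2 * PI * INR m)).
Definition wrap (v : R) : R := half_wrap v + half_wrap (2 * PI - v).

Lemma phi_wrap x y : phi beta x y = 2 * PI * wrap (y - x).
Proof.
  unfold phi, wrap, half_wrap. do 2 f_equal. apply Series_ext. intros m.
  rewrite <- gauss_even. f_equal. rewrite S_INR. ring.
Qed.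

(** From [(Rabs v - 2 * beta) ^ 2 >= 0] one gets [exp (- v ^ 2 / (2 * beta)) <= exp (2 * beta - 2 *
    Rabs v)]. One factor [exp (- Rabs v)] absorbs the linear weight [1 + Rabs v / beta], so the
    constant serves both the Gaussian and its derivative. *)
Definition decay_const : R := exp (2 * beta) * (1 + / beta) / sqrt (2 * PI * beta).

Lemma decay_const_pos : 0 < decay_const.
Proof.
  pose proof (gauss_den_pos beta beta_pos). pose proof (exp_pos (2 * beta)).
  assert (0 < / beta) by now apply Rinv_0_lt_compat.
  apply Rdiv_lt_0_compat; [apply Rmult_lt_0_compat|]; lra.
Qed.

Lemma gauss_weighted v : (1 + Rabs v / beta) * gauss beta v <= decay_const * exp (- Rabs v).
Proof.
  pose proof (gauss_den_pos beta beta_pos) as Hd. unfold decay_const, gauss.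
  assert (Hb : 0 < / beta) by now apply Rinv_0_lt_compat.
  assert (H : (1 + Rabs v / beta) * exp (- v ^ 2 / (2 * beta)) <= exp (2 * beta) * (1 + / beta) * exp
    (- Rabs v)).
  { assert (H1 : 1 + Rabs v / beta <= (1 + / beta) * exp (Rabs v)).
    { pose proof (exp_ineq1_le (Rabs v)). pose proof (Rabs_pos v). unfold Rdiv. nra. }
    assert (H2 : exp (- v ^ 2 / (2 * beta)) <= exp (2 * beta - 2 * Rabs v)).
    { apply exp_le_mono. apply (Rmult_le_reg_r (2 * beta)); [lra|].
      unfold Rdiv. rewrite Rmult_assoc, Rinv_l, Rmult_1_r by lra.
      assert (E : v ^ 2 = Rabs v * Rabs v) by (rewrite <- Rabs_mult, Rabs_right; nra).
      rewrite E. pose proof (Rle_0_sqr (Rabs v - 2 * beta)) as Hq. unfold Rsqr in Hq. lra. }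
    apply Rle_trans with ((1 + / beta) * exp (Rabs v) * exp (2 * beta - 2 * Rabs v)).
    - apply Rmult_le_compat; [|apply Rlt_le, exp_pos|easy|easy].
      pose proof (Rabs_pos v). assert (0 <= Rabs v / beta) by (apply Rmult_le_pos; lra). lra.
    - apply Req_le. replace (exp (2 * beta) * (1 + / beta) * exp (- Rabs v)) with
        ((1 + / beta) * (exp (2 * beta) * exp (- Rabs v))) by ring.
      rewrite Rmult_assoc. f_equal. rewrite <- !exp_plus. f_equal. ring. }
  apply (Rmult_le_compat_r (/ sqrt (2 * PI * beta))) in H; [|apply Rlt_le, Rinv_0_lt_compat; lra].
  unfold Rdiv in *. lra.
Qed.

Lemma gauss_decay v : gauss beta v <= decay_const * exp (- Rabs v).
Proof.
  apply Rle_trans with (2 := gauss_weighted v). pose proof (gauss_pos beta v beta_pos).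
  assert (0 <= Rabs v / beta) by (apply Rmult_le_pos; [apply Rabs_pos|apply Rlt_le, Rinv_0_lt_compat;
    lra]). nra.
Qed.

Lemma gauss_derive_decay v : Rabs (- v / beta * gauss beta v) <= decay_const * exp (- Rabs v).
Proof.
  apply Rle_trans with (2 := gauss_weighted v). pose proof (gauss_pos beta v beta_pos).
  assert (Hi : 0 < / beta) by now apply Rinv_0_lt_compat.
  rewrite Rabs_mult, (Rabs_right (gauss _ _)) by lra.
  unfold Rdiv. rewrite Rabs_mult, Rabs_Ropp, (Rabs_right (/ beta)) by lra. nra.
Qed.

Lemma exp_2PI_half m : exp (- (2 * PI * INR m)) <= (1 / 2) ^ m.
Proof.
  pose proof PI2_3_2.
  induction m as [|m IH].
  - simpl. rewrite Rmult_0_r, Ropp_0, exp_0. lra.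
  - rewrite S_INR. replace (- (2 * PI * (INR m + 1))) with (- (2 * PI) + - (2 * PI * INR m)) by ring.
    rewrite exp_plus. simpl. apply Rmult_le_compat; auto using Rlt_le, exp_pos.
    apply Rle_trans with (1 := exp_neg_le_inv (2 * PI) ltac:(lra)).
    unfold Rdiv. rewrite Rmult_1_l. apply Rinv_le_contravar; lra.
Qed.

Lemma half_wrap_term v m : 0 <= gauss beta (v + 2 * PI * INR m) <= decay_const * exp (Rabs v) * (1 /
  2) ^ m.
Proof.
  split; [now apply Rlt_le, gauss_pos|]. apply Rle_trans with (1 := gauss_decay _).
  rewrite (Rmult_assoc decay_const). apply Rmult_le_compat_l; [apply Rlt_le, decay_const_pos|].
  apply Rle_trans with (exp (Rabs v) * exp (- (2 * PI * INR m))).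
  - rewrite <- exp_plus. apply exp_le_mono.
    assert (2 * PI * INR m <= Rabs (v + 2 * PI * INR m) + Rabs v); [|lra].
    replace (2 * PI * INR m) with ((v + 2 * PI * INR m) + - v) at 1 by ring.
    rewrite <- (Rabs_Ropp v). apply Rle_trans with (1 := Rle_abs _). apply Rabs_triang.
  - apply Rmult_le_compat_l; [apply Rlt_le, exp_pos|apply exp_2PI_half].
Qed.

Lemma half_wrap_term_nonneg v m : 0 <= v -> gauss beta (v + 2 * PI * INR m) <= decay_const * exp (-
  v) * (1 / 2) ^ m.
Proof.
  intros Hv. pose proof PI_RGT_0. pose proof (pos_INR m).
  assert (0 <= 2 * PI * INR m) by (apply Rmult_le_pos; lra).
  apply Rle_trans with (1 := gauss_decay _). rewrite (Rmult_assoc decay_const).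
  apply Rmult_le_compat_l; [apply Rlt_le, decay_const_pos|]. rewrite Rabs_right by lra.
  replace (- (v + 2 * PI * INR m)) with (- v + - (2 * PI * INR m)) by ring. rewrite exp_plus.
  apply Rmult_le_compat_l; [apply Rlt_le, exp_pos|apply exp_2PI_half].
Qed.

Lemma half_series c : is_series (fun m => c * (1 / 2) ^ m) (2 * c).
Proof.
  replace (2 * c) with (scal c (/ (1 - 1 / 2))) by (unfold scal; simpl; unfold mult; simpl; field).
  apply (is_series_scal c (fun m => (1/2) ^ m)). apply is_series_geom. rewrite Rabs_right; lra.
Qed.

Lemma half_wrap_ex v : ex_series (fun m => gauss beta (v + 2 * PI * INR m)).
Proof.
  apply (ex_series_le (V := R_CompleteNormedModule)) with (fun m => decay_const * exp (Rabs v) * (1 /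
    2) ^ m).
  - intros m. pose proof (half_wrap_term v m). unfold norm; simpl. unfold abs; simpl.
  rewrite Rabs_right; lra.
  - eexists. apply half_series.
Qed.

Lemma half_wrap_pos v : 0 <= half_wrap v.
Proof.
  assert (E : Series (fun m => 0 * (1 / 2) ^ m) = 0)
    by (rewrite (is_series_unique _ _ (half_series 0)); ring).
  rewrite <- E. apply Series_le; [|apply half_wrap_ex].
  intros m. pose proof (half_wrap_term v m). rewrite Rmult_0_l. lra.
Qed.

Lemma half_wrap_le v : 0 <= v -> half_wrap v <= 2 * (decay_const * exp (- v)).
Proof.
  intros Hv. rewrite <- (is_series_unique _ _ (half_series (decay_const * exp (- v)))).
  apply Series_le; [|eexists; apply half_series]. intros m.
  pose proof (half_wrap_term v m). pose proof (half_wrap_term_nonneg v m Hv). lra.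
Qed.

Lemma half_wrap_step v : half_wrap v = gauss beta v + half_wrap (v + 2 * PI).
Proof.
  unfold half_wrap. rewrite Series_incr_1 by apply half_wrap_ex. f_equal.
  - f_equal. simpl. ring.
  - apply Series_ext. intros m. f_equal. rewrite S_INR. ring.
Qed.

(** Mean value theorem term by term: for nonnegative arguments the intermediate point of the [m]-th
    term is at least [2 * PI * INR m], so the derivatives are dominated by a geometric series. *)
Lemma half_wrap_lip v w : 0 <= v -> 0 <= w -> Rabs (half_wrap v - half_wrap w) <= 2 * decay_const *
  Rabs (v - w).
Proof.
  intros Hv Hw.
  assert (T : forall m, Rabs (gauss beta (v + 2 * PI * INR m) - gauss beta (w + 2 * PI * INR m))
                 <= decay_const * Rabs (v - w) * (1 / 2) ^ m).
  { intros m. pose proof PI_RGT_0. pose proof (pos_INR m).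
    assert (0 <= 2 * PI * INR m) by (apply Rmult_le_pos; lra).
    set (a := 2 * PI * INR m) in *.
    destruct (MVT_gen (gauss beta) (w + a) (v + a) (fun c => - c / beta * gauss beta c)) as (c & Hc &
      E).
    - intros; now apply gauss_derive.
    - intros c _. apply continuity_pt_filterlim. now apply cts_gauss.
    - rewrite E, Rabs_mult. replace (v + a - (w + a)) with (v - w) by ring.
      assert (Hca : a <= c).
      { apply Rle_trans with (2 := proj1 Hc). apply Rmin_glb; lra. }
      replace (decay_const * Rabs (v - w) * (1 / 2) ^ m) with (decay_const * (1 / 2) ^ m * Rabs (v -
        w)) by ring.
      apply Rmult_le_compat_r; [apply Rabs_pos|].
      apply Rle_trans with (1 := gauss_derive_decay c).
      apply Rmult_le_compat_l; [apply Rlt_le, decay_const_pos|].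
      apply Rle_trans with (2 := exp_2PI_half m).
      apply exp_le_mono. rewrite Rabs_right by lra. fold a. lra. }
  unfold half_wrap. rewrite <- Series_minus by apply half_wrap_ex.
  replace (2 * decay_const * Rabs (v - w)) with (2 * (decay_const * Rabs (v - w))) by ring.
  rewrite <- (is_series_unique _ _ (half_series (decay_const * Rabs (v - w)))).
  eapply Rle_trans.
  - apply Series_Rabs. apply (ex_series_le (V := R_CompleteNormedModule)) with (fun m => decay_const
    * Rabs (v - w) * (1 / 2) ^ m).
    + intros m. unfold norm; simpl. unfold abs; simpl. rewrite Rabs_Rabsolu. apply T.
    + eexists; apply half_series.
  - apply Series_le; [|eexists; apply half_series]. intros m. split; [apply Rabs_pos|apply T].
Qed.

Lemma wrap_even v : wrap (- v) = wrap v.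
Proof.
  unfold wrap. rewrite (half_wrap_step (- v)), (half_wrap_step v), gauss_even.
  replace (2 * PI - - v) with (v + 2 * PI) by ring. replace (- v + 2 * PI) with (2 * PI - v) by ring.
  ring.
Qed.

Lemma wrap_period1 v : wrap (v + 2 * PI) = wrap v.
Proof.
  unfold wrap. rewrite (half_wrap_step v). replace (2 * PI - (v + 2 * PI)) with (- v) by ring.
  rewrite (half_wrap_step (- v)), gauss_even. replace (- v + 2 * PI) with (2 * PI - v) by ring. ring.
Qed.

Lemma period_Z (f : R -> R) : (forall v, f (v + 2 * PI) = f v) ->
  forall (k : Z) v, f (v + 2 * PI * IZR k) = f v.
Proof.
  intros H.
  assert (HN : forall n v, f (v + 2 * PI * INR n) = f v).
  { induction n as [|n IH]; intros v.
    - simpl. f_equal. ring.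
    - rewrite S_INR. rewrite <- (H v), <- (IH (v + 2 * PI)). f_equal. ring. }
  intros k v. destruct (Z.le_gt_cases 0 k).
  - rewrite <- (Z2Nat.id k) by lia. rewrite <- INR_IZR_INZ. apply HN.
  - rewrite <- (HN (Z.to_nat (- k)) (v + 2 * PI * IZR k)). f_equal.
  rewrite INR_IZR_INZ, Z2Nat.id by lia.
    rewrite opp_IZR. ring.
Qed.

Lemma reduce_2PI a v : exists k : Z, a <= v - 2 * PI * IZR k < a + 2 * PI.
Proof.
  pose proof two_PI_pos as HP. exists (Int_part ((v - a) / (2 * PI))).
  destruct (base_Int_part ((v - a) / (2 * PI))) as [H1 H2].
  set (k := IZR (Int_part ((v - a) / (2 * PI)))) in *.
  apply (Rmult_le_compat_l (2 * PI)) in H1; [|lra].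
  assert (E : 2 * PI * ((v - a) / (2 * PI)) = v - a) by (field; lra).
  assert (H3 : (v - a) / (2 * PI) < k + 1) by lra.
  apply (Rmult_lt_compat_l (2 * PI)) in H3; [|lra]. lra.
Qed.

Lemma wrap_period k v : wrap (v + 2 * PI * IZR k) = wrap v.
Proof. apply (period_Z wrap wrap_period1). Qed.

Lemma wrap_pos v : 0 <= wrap v.
Proof. unfold wrap. pose proof (half_wrap_pos v). pose proof (half_wrap_pos (2 * PI - v)). lra. Qed.

Lemma wrap_le v : wrap v <= 4 * decay_const.
Proof.
  destruct (reduce_2PI 0 v) as [k Hk]. set (w := v - 2 * PI * IZR k) in *.
  replace v with (w + 2 * PI * IZR k) by (unfold w; ring). rewrite wrap_period.
  assert (H : forall u, 0 <= u -> half_wrap u <= 2 * decay_const).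
  { intros u Hu. apply Rle_trans with (1 := half_wrap_le u Hu). pose proof decay_const_pos.
    assert (exp (- u) <= 1) by (rewrite <- exp_0; apply exp_le_mono; lra). nra. }
  unfold wrap. pose proof (H w ltac:(lra)). pose proof (H (2 * PI - w) ltac:(lra)). lra.
Qed.

(** On [0, 2 PI] both halves of [wrap] have nonnegative arguments and [half_wrap_lip] applies. Other
    points are reduced by periodicity. *)
Lemma wrap_lip v w : Rabs (wrap v - wrap w) <= 4 * decay_const * Rabs (v - w).
Proof.
  pose proof two_PI_pos as HP. pose proof decay_const_pos as HK.
  assert (L0 : forall v w, 0 <= v <= 2 * PI -> 0 <= w <= 2 * PI ->
    Rabs (wrap v - wrap w) <= 4 * decay_const * Rabs (v - w)).
  { intros a b Ha Hb. unfold wrap.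
    pose proof (half_wrap_lip a b ltac:(lra) ltac:(lra)).
    pose proof (half_wrap_lip (2 * PI - a) (2 * PI - b) ltac:(lra) ltac:(lra)) as H2.
    replace (2 * PI - a - (2 * PI - b)) with (- (a - b)) in H2 by ring. rewrite Rabs_Ropp in H2.
    replace (half_wrap a + half_wrap (2 * PI - a) - (half_wrap b + half_wrap (2 * PI - b))) with
      ((half_wrap a - half_wrap b) + (half_wrap (2 * PI - a) - half_wrap (2 * PI - b))) by ring.
    apply Rle_trans with (1 := Rabs_triang _ _). lra. }
  assert (L1 : forall v w, v <= w -> Rabs (wrap v - wrap w) <= 4 * decay_const * (w - v)).
  { intros a b Hab. destruct (reduce_2PI 0 a) as [k Hk]. destruct (reduce_2PI 0 b) as [l Hl].
    rewrite <- (wrap_period (- k) a), <- (wrap_period (- l) b). rewrite !opp_IZR.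
    replace (a + 2 * PI * - IZR k) with (a - 2 * PI * IZR k) by ring.
    replace (b + 2 * PI * - IZR l) with (b - 2 * PI * IZR l) by ring.
    destruct (Z.eq_dec k l) as [<-|Hkl].
    - eapply Rle_trans; [apply L0; lra|]. rewrite (Rabs_left1 (_ - _ - (_ - _))) by lra. lra.
    - assert (Hlt : (k < l)%Z).
      { apply Z.nle_gt. intros Hle. assert (Hle' : (l + 1 <= k)%Z) by lia. apply IZR_le in Hle'.
      rewrite plus_IZR in Hle'.
        apply (Rmult_le_compat_l (2 * PI)) in Hle'; lra. }
      assert (Hkl' : IZR k + 1 <= IZR l) by (rewrite <- plus_IZR; apply IZR_le; lia).
      set (a' := a - 2 * PI * IZR k) in *. set (b' := b - 2 * PI * IZR l) in *.
      assert (E : wrap (2 * PI) = wrap 0) by (rewrite <- (wrap_period1 0); f_equal; ring).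
      (* When the points lie in different periods the path is cut at [2 * PI], identified with 0;
         the two pieces together are no longer than [b - a]. *)
      replace (wrap a' - wrap b') with ((wrap a' - wrap (2 * PI)) + (wrap 0 - wrap b'))
        by (rewrite E; ring).
      apply Rle_trans with (1 := Rabs_triang _ _).
      pose proof (L0 a' (2 * PI) ltac:(lra) ltac:(lra)) as J1.
      pose proof (L0 0 b' ltac:(lra) ltac:(lra)) as J2.
      rewrite (Rabs_left1 (a' - 2 * PI)) in J1 by lra. rewrite (Rabs_left1 (0 - b')) in J2 by lra.
      pose proof (Rmult_le_compat_l (2 * PI) _ _ ltac:(lra) Hkl') as J3.
      assert (J4 : 2 * PI - a' + b' <= b - a) by (unfold a', b'; lra).
      apply (Rmult_le_compat_l (4 * decay_const)) in J4; lra. }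
  destruct (Rle_dec v w).
  - rewrite (Rabs_left1 (v - w)) by lra. replace (- (v - w)) with (w - v) by ring. now apply L1.
  - rewrite (Rabs_right (v - w)), Rabs_minus_sym by lra. apply L1. lra.
Qed.

Lemma wrap_cts : cts wrap.
Proof. apply cts_lip with (4 * decay_const). apply wrap_lip. Qed.

Lemma phi_bounded_lip : bounded_lip2 dR dR (phi beta).
Proof.
  pose proof two_PI_pos as HP. pose proof decay_const_pos as HK.
  assert (0 < 2 * PI * (4 * decay_const)) by (apply Rmult_lt_0_compat; lra).
  exists (2 * PI * (4 * decay_const)). split; [lra|]. split.
  - intros [x y]. simpl. rewrite phi_wrap, Rabs_mult, (Rabs_right (2 * PI)) by lra.
    apply Rmult_le_compat_l; [lra|]. rewrite Rabs_right by (apply Rle_ge, wrap_pos). apply wrap_le.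
  - intros [x y] [x' y']. unfold prod_dist, dR; simpl.
  rewrite !phi_wrap, <- Rmult_minus_distr_l, Rabs_mult, (Rabs_right (2 * PI)) by lra.
    rewrite (Rmult_assoc (2 * PI)). apply Rmult_le_compat_l; [lra|].
    apply Rle_trans with (1 := wrap_lip _ _).
    apply Rmult_le_compat_l; [lra|]. replace (y - x - (y' - x')) with ((y - y') + - (x - x')) by ring.
    apply Rle_trans with (1 := Rabs_triang _ _). rewrite Rabs_Ropp. lra.
Qed.

Lemma phi_pos x y : 0 <= phi beta x y.
Proof. rewrite phi_wrap. pose proof two_PI_pos. apply Rmult_le_pos; [lra|apply wrap_pos]. Qed.

Lemma sumN_sum_n f n : sum_n f n = sumN (S n) f.
Proof.
  induction n as [|n IH].
  - rewrite sum_O. simpl. now rewrite Rplus_0_r.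
  - rewrite sum_Sn, IH. replace (S (S n)) with (S n + 1)%nat by lia. rewrite sumN_plus.
  change (sumN 1 ?g) with (g O + 0); cbv beta.
    rewrite Nat.add_0_r, Rplus_0_r. reflexivity.
Qed.

Lemma half_wrap_lim v : is_lim_seq (fun n => sumN (S n) (fun j => gauss beta (v + 2 * PI * INR j)))
  (half_wrap v).
Proof.
  apply (is_lim_seq_ext (sum_n (fun j => gauss beta (v + 2 * PI * INR j)))).
  - intros; apply sumN_sum_n.
  - apply Series_correct, half_wrap_ex.
Qed.

Lemma wrapN_lim v : is_lim_seq (fun n => wrapN beta (S n) v) (wrap v).
Proof.
  apply is_lim_seq_plus'.
  - apply (is_lim_seq_incr_1 (fun n => sumN (S n) (fun j => gauss beta (v + 2 * PI * INR j)))),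
    half_wrap_lim.
  - apply half_wrap_lim.
Qed.

(** Positivity of the Dirichlet heat kernel of the half circle. The limit of the truncations is
    taken at the fixed time [beta], so the heat equation is used for finite sums only. *)
Lemma wrap_reflection u d : 0 <= u <= PI -> 0 <= d <= PI -> wrap (u + d) <= wrap (u - d).
Proof.
  intros Hu Hd.
  apply (is_lim_seq_le (fun n => wrapN beta (S n) (u + d)) (fun n => wrapN beta (S n) (u - d))
           (wrap (u + d)) (wrap (u - d))); [|apply wrapN_lim|apply wrapN_lim].
  intros n. now apply wrapN_reflection.
Qed.

End Wrapped.

(** * Contraction of the chord distance *)

(** Goals left by [RInt_ext] compare elements of the carrier of a module structure; the [change]
    exposes [R] to [ring]. *)
Ltac ring_R := match goal with |- ?a = ?b => change (@eq R a b) end; ring.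

Lemma RInt_shift (f : R -> R) c a b : cts f -> RInt (fun t => f (t + c)) a b = RInt f (a + c) (b + c).
Proof.
  intros Hf. pose proof (RInt_comp_lin (V := R_CompleteNormedModule) f 1 c a b) as H.
  rewrite !Rmult_1_l in H. rewrite <- H by now apply cts_ex_RInt.
  apply RInt_ext. intros t _. unfold scal; simpl; unfold mult; simpl. now rewrite !Rmult_1_l.
Qed.

Lemma RInt_reflect (f : R -> R) c a b : cts f -> RInt (fun t => f (c - t)) a b = RInt f (c - b) (c - a).
Proof.
  intros Hf. pose proof (RInt_comp_lin (V := R_CompleteNormedModule) f (-1) c a b) as H.
  rewrite <- (opp_RInt_swap f (c - a) (c - b)) by now apply cts_ex_RInt.
  replace (c - a) with (-1 * a + c) by ring. replace (c - b) with (-1 * b + c) by ring.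
  rewrite <- H by now apply cts_ex_RInt.
  assert (Hc : cts (fun t => f (-1 * t + c))).
  { apply (cts_comp f); trivial. apply cts_plus; auto using cts_mult, cts_const, cts_id. }
  rewrite <- (RInt_opp (V := R_CompleteNormedModule)).
  - apply RInt_ext. intros t _. unfold scal, opp; simpl; unfold mult; simpl.
    replace (c - t) with (-1 * t + c) by ring.
    ring_R.
  - apply (ex_RInt_scal (V := R_NormedModule) (fun t => f (-1 * t + c))). now apply cts_ex_RInt.
Qed.

Lemma RInt_Chasles_cts (f : R -> R) a b c : cts f -> RInt f a b + RInt f b c = RInt f a c.
Proof. intros Hf. apply (RInt_Chasles (V := R_CompleteNormedModule)); now apply cts_ex_RInt. Qed.

Lemma RInt_period (f : R -> R) a : cts f -> (forall v, f (v + 2 * PI) = f v) ->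
  RInt f a (a + 2 * PI) = RInt f 0 (2 * PI).
Proof.
  intros Hf Hp.
  rewrite <- (RInt_Chasles_cts f a 0 (a + 2 * PI)),
    <- (RInt_Chasles_cts f 0 (2 * PI) (a + 2 * PI)) by easy.
  replace (2 * PI) with (0 + 2 * PI) at 2 by ring. rewrite <- (RInt_shift f (2 * PI) 0 a) by easy.
  rewrite (RInt_ext (fun t => f (t + 2 * PI)) f 0 a) by (intros; apply Hp).
  pose proof (RInt_Chasles_cts f a 0 a Hf) as H. rewrite RInt_point in H.
  unfold zero in H; simpl in H. lra.
Qed.

Lemma RInt_plus_cts (f g : R -> R) a b : cts f -> cts g ->
  RInt (fun t => f t + g t) a b = RInt f a b + RInt g a b.
Proof. intros. apply (RInt_plus (V := R_CompleteNormedModule)); now apply cts_ex_RInt. Qed.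

Lemma RInt_minus_cts (f g : R -> R) a b : cts f -> cts g ->
  RInt (fun t => f t - g t) a b = RInt f a b - RInt g a b.
Proof. intros. apply (RInt_minus (V := R_CompleteNormedModule)); now apply cts_ex_RInt. Qed.

Lemma RInt_scal_cts (f : R -> R) a b c : cts f -> RInt (fun t => c * f t) a b = c * RInt f a b.
Proof. intros. apply (RInt_scal (V := R_CompleteNormedModule) f); now apply cts_ex_RInt. Qed.

Lemma RInt_fold (f : R -> R) a : cts f -> RInt f (- a) a = RInt (fun u => f u + f (- u)) 0 a.
Proof.
  intros Hf.
  assert (Hc : cts (fun u => f (- u))).
  { apply (cts_comp f (fun u => - u)); trivial. apply cts_derivable. intros x. auto_derive. easy. }
  rewrite RInt_plus_cts by easy. rewrite <- (RInt_Chasles_cts f (- a) 0 a) by easy.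
  rewrite (RInt_ext (fun u => f (- u)) (fun u => f (0 - u))) by (intros u _; now rewrite Rminus_0_l).
  rewrite RInt_reflect by easy. replace (0 - a) with (- a) by ring. replace (0 - 0) with 0 by ring.
  ring_R.
Qed.

Lemma cts_sin : cts sin.
Proof. apply cts_derivable. intros x. auto_derive. easy. Qed.
Lemma cts_cos : cts cos.
Proof. apply cts_derivable. intros x. auto_derive. easy. Qed.
Lemma cts_shift f c : cts f -> cts (fun u => f (u + c)).
Proof. intros Hf. apply (cts_comp f (fun u => u + c)); auto using cts_plus, cts_const, cts_id. Qed.
Lemma cts_shift' f c : cts f -> cts (fun u => f (u - c)).
Proof. intros Hf. apply (cts_comp f (fun u => u - c)); auto using cts_minus, cts_const, cts_id. Qed.
Lemma cts_refl f c : cts f -> cts (fun u => f (c - u)).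
Proof. intros Hf. apply (cts_comp f (fun u => c - u)); auto using cts_minus, cts_const, cts_id. Qed.
Lemma cts_sumN n (F : nat -> R -> R) : (forall j, cts (F j)) -> cts (fun v => sumN n (fun j => F j v)).
Proof.
  revert F. induction n as [|n IH]; intros F H; simpl; [apply cts_const|].
  apply (cts_plus (F O)); auto.
Qed.

(** Unwrapping: the translates over one period tile [M] consecutive periods. *)
Lemma RInt_sumN_shift (f : R -> R) M a : cts f ->
  RInt (fun v => sumN M (fun j => f (v + a + 2 * PI * INR j))) 0 (2 * PI) = RInt f a (a + 2 * PI *
    INR M).
Proof.
  intros Hf. revert a. induction M as [|M IH]; intros a.
  - simpl. rewrite RInt_const. replace (a + 2 * PI * 0) with a by ring. rewrite RInt_point.
    unfold scal, zero; simpl; unfold mult; simpl. ring.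
  - cbn [sumN].
    assert (Hc : forall b, cts (fun v => f (v + b + 2 * PI * INR 0))) by (intros b;
      exact (cts_shift _ b (cts_shift f (2 * PI * INR 0) Hf))).
    rewrite RInt_plus_cts; [|apply Hc|].
    + rewrite (RInt_ext _ (fun t => f (t + a))) by (intros t _; simpl INR;
      now rewrite Rmult_0_r, Rplus_0_r).
      rewrite RInt_shift by easy.
      rewrite (RInt_ext (fun t => sumN M _) (fun v => sumN M (fun j => f (v + (a + 2 * PI) + 2 * PI *
        INR j)))).
      * rewrite IH, S_INR. replace (0 + a) with a by ring.
        replace (2 * PI + a) with (a + 2 * PI) by ring.
        rewrite RInt_Chasles_cts by easy. f_equal. ring.
      * intros v _. apply sumN_ext. intros j _. rewrite S_INR. f_equal. ring.
    + apply (cts_sumN M (fun j v => f (v + a + 2 * PI * INR (S j)))). intros j.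
      exact (cts_shift _ a (cts_shift f (2 * PI * INR (S j)) Hf)).
Qed.

Section Circle.

Variable beta : R.
Hypothesis beta_pos : 0 < beta.

Local Notation W := (wrap beta).

Lemma half_wrap_steps M v : half_wrap beta v = sumN M (fun j => gauss beta (v + 2 * PI * INR j)) +
  half_wrap beta (v + 2 * PI * INR M).
Proof.
  revert v. induction M as [|M IH]; intros v.
  - simpl. rewrite Rplus_0_l. f_equal. ring.
  - cbn [sumN]. rewrite half_wrap_step by easy. rewrite (IH (v + 2 * PI)).
    rewrite (sumN_ext M (fun j => gauss beta (v + 2 * PI * INR (S j))) (fun j => gauss beta (v + 2 *
      PI + 2 * PI * INR j)))
      by (intros j _; f_equal; rewrite S_INR; ring).
    replace (v + 2 * PI * INR (S M)) with (v + 2 * PI + 2 * PI * INR M) by (rewrite S_INR; ring).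
    replace (v + 2 * PI * INR 0) with v by (simpl; ring). ring.
Qed.

(** The two halves of [wrap] are exchanged by [v] to [2 * PI - v], hence the factor 2 on the
    Gaussian integral. Each of the two discarded tails is at most
    [2 * decay_const beta * (1 / 2) ^ M]. *)
Lemma wrap_integral_approx M :
  Rabs (RInt W 0 (2 * PI) - 2 * RInt (gauss beta) 0 (2 * PI * INR M)) <= (2 * PI - 0) * (4 *
    decay_const beta * (1 / 2) ^ M).
Proof.
  pose proof two_PI_pos as HP. pose proof (cts_gauss beta beta_pos) as Hg.
  pose proof (wrap_cts beta beta_pos) as HW.
  set (s := fun v => sumN M (fun j => gauss beta (v + 2 * PI * INR j))).
  assert (Hs : cts s).
  { apply (cts_sumN M (fun j v => gauss beta (v + 2 * PI * INR j))). intros j. now apply cts_shift. }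
  assert (E : 2 * RInt (gauss beta) 0 (2 * PI * INR M) = RInt (fun v => s v + s (2 * PI - v)) 0 (2 *
    PI)).
  { rewrite RInt_plus_cts by (auto using cts_refl). rewrite RInt_reflect by easy.
    replace (2 * PI - 2 * PI) with 0 by ring. replace (2 * PI - 0) with (2 * PI) by ring.
    rewrite (RInt_ext s (fun v => sumN M (fun j => gauss beta (v + 0 + 2 * PI * INR j)))).
    - rewrite (RInt_sumN_shift (gauss beta) M 0) by easy. rewrite Rplus_0_l. ring.
    - intros v _. unfold s. now rewrite Rplus_0_r. }
  rewrite E, <- RInt_minus_cts by (auto using cts_plus, cts_refl).
  apply abs_RInt_le_const; [lra| |].
  - apply cts_ex_RInt, cts_minus; auto using cts_plus, cts_refl.
  - intros v Hv. unfold wrap. rewrite (half_wrap_steps M v), (half_wrap_steps M (2 * PI - v)).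
  fold (s v) (s (2 * PI - v)).
    match goal with |- Rabs ?e <= _ => replace e with
      (half_wrap beta (v + 2 * PI * INR M) + half_wrap beta (2 * PI - v + 2 * PI * INR M)) by ring end.
    assert (HM : 0 <= 2 * PI * INR M) by (apply Rmult_le_pos; [lra|apply pos_INR]).
    assert (HU : forall u, 0 <= u -> half_wrap beta (u + 2 * PI * INR M) <= 2 * decay_const beta * (1
      / 2) ^ M).
    { intros u Hu. apply Rle_trans with (1 := half_wrap_le beta beta_pos (u + 2 * PI * INR M)
      ltac:(lra)).
      rewrite <- Rmult_assoc. apply Rmult_le_compat_l; [pose proof (decay_const_pos beta beta_pos);
        lra|].
      apply Rle_trans with (2 := exp_2PI_half M). apply exp_le_mono. lra. }
    pose proof (HU v ltac:(lra)). pose proof (HU (2 * PI - v) ltac:(lra)).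
    pose proof (half_wrap_pos beta beta_pos (v + 2 * PI * INR M)).
    pose proof (half_wrap_pos beta beta_pos (2 * PI - v + 2 * PI * INR M)).
    rewrite Rabs_right; lra.
Qed.

Lemma wrap_integral : RInt W 0 (2 * PI) = 1.
Proof.
  pose proof two_PI_pos as HP. set (I := RInt W 0 (2 * PI)).
  set (x := fun M => 2 * RInt (gauss beta) 0 (2 * PI * INR M)).
  set (c := (2 * PI - 0) * (4 * decay_const beta)).
  assert (H : forall M, Rabs (I - x M) <= c * (1 / 2) ^ M).
  { intros M. apply Rle_trans with (1 := wrap_integral_approx M). unfold c. lra. }
  assert (L0 : is_lim_seq (fun M => c * (1 / 2) ^ M) 0).
  { replace (Finite 0) with (Rbar_mult c 0) by (simpl; now rewrite Rmult_0_r).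
    apply is_lim_seq_scal_l, is_lim_seq_geom. rewrite Rabs_right; lra. }
  assert (L1 : is_lim_seq x I).
  { apply is_lim_seq_le_le with (fun M => I - c * (1 / 2) ^ M) (fun M => I + c * (1 / 2) ^ M).
    - intros M. specialize (H M). apply Rabs_le_between in H. lra.
    - replace (Finite I) with (Finite (I - 0)) by (f_equal; ring).
    apply is_lim_seq_minus'; [apply is_lim_seq_const|easy].
    - replace (Finite I) with (Finite (I + 0)) by (f_equal; ring).
    apply is_lim_seq_plus'; [apply is_lim_seq_const|easy]. }
  assert (L2 : is_lim_seq x 1).
  { replace (Finite 1) with (Rbar_mult 2 (1 / 2)) by (simpl; f_equal; field).
    apply is_lim_seq_scal_l, gauss_half_integral; [easy|].
    replace p_infty with (Rbar_mult (2 * PI) p_infty).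
    - apply is_lim_seq_scal_l, is_lim_seq_INR.
    - simpl. destruct (Rle_dec 0 (2 * PI)) as [H'|H']; [|lra].
    destruct (Rle_lt_or_eq_dec 0 (2 * PI) H'); [easy|lra]. }
  pose proof (is_lim_seq_unique _ _ L1) as E1. rewrite (is_lim_seq_unique _ _ L2) in E1. congruence.
Qed.

Lemma int1_phi x f : cts f -> int1 (fun t => phi beta x t * f t) = RInt (fun t => W (t - x) * f t) 0
  (2 * PI).
Proof.
  intros Hf. pose proof two_PI_pos as HP. unfold int1.
  rewrite (RInt_ext _ (fun t => (2 * PI) * (W (t - x) * f t))) by (intros; rewrite phi_wrap; simpl;
    apply Rmult_assoc).
  rewrite RInt_scal_cts; [field; lra|]. apply cts_mult; trivial. apply cts_shift', wrap_cts, beta_pos.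
Qed.

Lemma phi_int x : int1 (phi beta x) = 1.
Proof.
  replace (phi beta x) with (fun t => phi beta x t * 1) by (apply functional_extensionality; intros;
    ring).
  rewrite int1_phi by apply cts_const.
  rewrite (RInt_ext _ (fun t => W (t + - x))) by (intros; rewrite Rmult_1_r; reflexivity).
  rewrite RInt_shift by (apply wrap_cts, beta_pos).
  replace (2 * PI + - x) with (0 + - x + 2 * PI) by ring.
  rewrite RInt_period; [apply wrap_integral|apply wrap_cts, beta_pos|now apply wrap_period1].
Qed.

Lemma lambda_wrap : lambda beta = RInt (fun w => W w * cos w) (- PI) PI.
Proof.
  pose proof two_PI_pos as HP.
  assert (Hc : cts (fun w => W w * cos w)) by (apply cts_mult;
    [apply wrap_cts, beta_pos|apply cts_cos]).
  unfold lambda. replace (fun x => cos x * phi beta 0 x) with (fun x => phi beta 0 x * cos x)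
    by (apply functional_extensionality; intros; ring).
  rewrite int1_phi by apply cts_cos.
  rewrite (RInt_ext _ (fun w => W w * cos w)) by (intros; now rewrite Rminus_0_r).
  rewrite <- (RInt_period (fun w => W w * cos w) (- PI)).
  - f_equal. ring.
  - easy.
  - intros v. rewrite wrap_period1 by easy. f_equal. rewrite cos_plus, cos_2PI, sin_2PI. ring.
Qed.

(** Convolution with the even kernel [W] has [sin] as eigenfunction: in the expansion of
    [sin (w + d)] the term with [W w * sin w] is odd and integrates to 0, and the other carries
    [lambda]. *)
Lemma wrap_sin_shift d : RInt (fun u => W (u - d) * sin u) (- PI) PI = lambda beta * sin d.
Proof.
  pose proof (wrap_cts beta beta_pos) as HW.
  assert (Hf : cts (fun w => W w * sin (w + d))) by (apply cts_mult; auto using cts_shift, cts_sin).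
  rewrite (RInt_ext _ (fun u => (fun w => W w * sin (w + d)) (u + - d))).
  2:{ intros u _. simpl. f_equal. f_equal. ring. }
  rewrite (RInt_shift (fun w => W w * sin (w + d))) by easy.
  replace (PI + - d) with (- PI + - d + 2 * PI) by ring.
  assert (Hp : forall v, W (v + 2 * PI) * sin (v + 2 * PI + d) = W v * sin (v + d)).
  { intros v. rewrite wrap_period1 by easy. f_equal.
    replace (v + 2 * PI + d) with (v + d + 2 * PI) by ring. rewrite sin_plus, cos_2PI, sin_2PI. ring. }
  rewrite (RInt_period (fun w => W w * sin (w + d))) by easy.
  rewrite <- (RInt_period (fun w => W w * sin (w + d)) (- PI)) by easy.
  replace (- PI + 2 * PI) with PI by ring.
  rewrite (RInt_ext _ (fun w => cos d * (W w * sin w) + sin d * (W w * cos w))).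
  2:{ intros w _. simpl. rewrite sin_plus. ring_R. }
  assert (Hs : cts (fun w => W w * sin w)) by (apply cts_mult; auto using cts_sin).
  assert (Hc : cts (fun w => W w * cos w)) by (apply cts_mult; auto using cts_cos).
  rewrite RInt_plus_cts by (apply cts_mult; auto using cts_const).
  rewrite !RInt_scal_cts by easy. rewrite <- lambda_wrap.
  rewrite (RInt_fold (fun w => W w * sin w)) by easy.
  rewrite (RInt_ext _ (fun _ => 0)).
  - rewrite RInt_const. unfold scal; simpl; unfold mult; simpl. ring.
  - intros u _. simpl. rewrite wrap_even, sin_neg by easy. ring_R.
Qed.

Lemma refl_kernel_odd d u : W (- u - d) - W (- u + d) = - (W (u - d) - W (u + d)).
Proof.
  rewrite <- (wrap_even beta beta_pos (- u - d)), <- (wrap_even beta beta_pos (- u + d)).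
  replace (- (- u - d)) with (u + d) by ring. replace (- (- u + d)) with (u - d) by ring. ring.
Qed.

Lemma cts_refl_kernel d : cts (fun u => W (u - d) - W (u + d)).
Proof.
  pose proof (wrap_cts beta beta_pos). apply cts_minus; auto using cts_shift, cts_shift'.
Qed.

(** The eigenvalue identity at [d] and [- d] gives twice the claim on the full circle. The integrand
    is a product of two odd functions, so half of it lives on [0, PI]. *)
Lemma refl_kernel_sin d : RInt (fun u => (W (u - d) - W (u + d)) * sin u) 0 PI = lambda beta * sin d.
Proof.
  pose proof (wrap_cts beta beta_pos) as HW. pose proof (cts_refl_kernel d) as Hk.
  assert (H1 : RInt (fun u => (W (u - d) - W (u + d)) * sin u) (- PI) PI = 2 * (lambda beta * sin d)).
  { rewrite (RInt_ext _ (fun u => W (u - d) * sin u - W (u - - d) * sin u)).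
    - rewrite RInt_minus_cts by (apply cts_mult; auto using cts_shift', cts_sin).
      rewrite !wrap_sin_shift, sin_neg. ring_R.
    - intros u _. replace (u - - d) with (u + d) by ring. ring_R. }
  assert (Hc : cts (fun u => (W (u - d) - W (u + d)) * sin u)) by (apply cts_mult; auto using cts_sin).
  rewrite RInt_fold in H1 by easy.
  rewrite (RInt_ext _ (fun u => 2 * ((W (u - d) - W (u + d)) * sin u))) in H1.
  - rewrite RInt_scal_cts in H1 by easy. lra.
  - intros u _. simpl. rewrite refl_kernel_odd, sin_neg. ring_R.
Qed.

(** At [d = PI / 2] the previous identity writes [lambda] as the integral of a nonnegative
    function. *)
Lemma lambda_nonneg : 0 <= lambda beta.
Proof.
  pose proof PI_RGT_0 as HP. pose proof (refl_kernel_sin (PI / 2)) as H.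
  rewrite sin_PI2, Rmult_1_r in H. rewrite <- H.
  apply RInt_ge_0; [lra| |].
  - apply cts_ex_RInt, cts_mult; auto using cts_sin, cts_refl_kernel.
  - intros u Hu. apply Rmult_le_pos; [|apply sin_ge_0; lra].
    pose proof (wrap_reflection beta beta_pos u (PI / 2) ltac:(lra) ltac:(lra)). lra.
Qed.

Lemma chord_period k x y : chord x (y + 2 * PI * IZR k) = chord x y.
Proof.
  apply (period_Z (fun y => chord x y)). intros v. unfold chord.
  replace ((x - (v + 2 * PI)) / 2) with ((x - v) / 2 - PI) by field.
  rewrite sin_minus, cos_PI, sin_PI.
  replace (sin ((x - v) / 2) * -1 - cos ((x - v) / 2) * 0) with (- sin ((x - v) / 2)) by ring.
  apply Rabs_Ropp.
Qed.

Lemma phi_period k x t : phi beta (x + 2 * PI * IZR k) t = phi beta x t.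
Proof.
  rewrite !phi_wrap by easy. f_equal. replace (t - (x + 2 * PI * IZR k)) with (t - x + 2 * PI * IZR
    (- k)).
  - now apply wrap_period.
  - rewrite opp_IZR. ring.
Qed.

(* Both averages are written on the circle centred at the midpoint [a] of the two base points
   (lifted to be at distance at most [2 PI]) and folded by the reflection about [a]; the folded
   kernel is nonnegative and has [sin] as eigenfunction. *)
Lemma phi_contr (g : R -> R) c : bounded_lip dR g ->
  (forall t t', Rabs (g t - g t') <= c * chord t t') ->
  forall x x', Rabs (int1 (fun t => phi beta x t * g t) - int1 (fun t => phi beta x' t * g t)) <= c *
    lambda beta * chord x x'.
Proof.
  intros Hg HL x x'. pose proof PI_RGT_0 as HP.
  pose proof (wrap_cts beta beta_pos) as HW. apply bounded_lip_cts in Hg.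
  destruct (reduce_2PI 0 (x - x')) as [k Hk].
  replace (fun t => phi beta x' t * g t) with (fun t => phi beta (x' + 2 * PI * IZR k) t * g t)
    by (apply functional_extensionality; intros t; now rewrite phi_period).
  rewrite <- (chord_period k x x').
  set (y := x' + 2 * PI * IZR k). set (d := (x - y) / 2). set (a := (x + y) / 2).
  assert (Hd : 0 <= d <= PI) by (unfold d, y; lra).
  assert (Hgp : forall v, g (v + 2 * PI) = g v).
  { intros v. specialize (HL (v + 2 * PI) v). unfold chord in HL.
    replace ((v + 2 * PI - v) / 2) with PI in HL by field. rewrite sin_PI, Rabs_R0, Rmult_0_r in HL.
    pose proof (Rabs_pos (g (v + 2 * PI) - g v)). apply Rminus_diag_uniq. 
    destruct (Req_dec (g (v + 2 * PI) - g v) 0) as [|Hn]; [easy|]. apply Rabs_pos_lt in Hn. lra. }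
  assert (HI : forall z e, a + e = z -> int1 (fun t => phi beta z t * g t) = RInt (fun u => W (u - e)
    * g (u + a)) (- PI) PI).
  { intros z e Hz. rewrite int1_phi by easy.
    assert (Hc : cts (fun t => W (t - z) * g t)) by (apply cts_mult; auto using cts_shift').
    rewrite <- (RInt_period (fun t => W (t - z) * g t) (- PI + a)); [|easy|].
    - replace (- PI + a + 2 * PI) with (PI + a) by ring. rewrite <- RInt_shift by easy.
      apply RInt_ext. intros u _. simpl. f_equal. f_equal. rewrite <- Hz. ring.
    - intros v. rewrite Hgp. f_equal. replace (v + 2 * PI - z) with (v - z + 2 * PI) by ring.
    now apply wrap_period1. }
  rewrite (HI x d) by (unfold a, d; field). rewrite (HI y (- d)) by (unfold a, d; field).
  rewrite <- RInt_minus_cts by (apply cts_mult; auto using cts_shift', cts_shift).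
  set (K := fun u => W (u - d) - W (u + d)).
  assert (HK : cts K) by apply cts_refl_kernel.
  rewrite (RInt_ext _ (fun u => K u * g (u + a))).
  2:{ intros u _. unfold K. replace (u - - d) with (u + d) by ring. ring_R. }
  rewrite (RInt_fold (fun u => K u * g (u + a))) by (apply cts_mult; auto using cts_shift).
  rewrite (RInt_ext _ (fun u => K u * (g (u + a) - g (a - u)))).
  2:{ intros u _. unfold K. rewrite refl_kernel_odd. replace (- u + a) with (a - u) by ring.
      ring_R. }
  assert (Hsd : chord x y = sin d) by (unfold chord; fold d; apply Rabs_right, Rle_ge, sin_ge_0; lra).
  rewrite Hsd. replace (c * lambda beta * sin d) with (c * (lambda beta * sin d)) by ring.
  rewrite <- (refl_kernel_sin d). fold K.
  rewrite <- RInt_scal_cts by (apply cts_mult; auto using cts_sin).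
  assert (HF : cts (fun u => K u * (g (u + a) - g (a - u)))) by (apply cts_mult; auto;
    apply cts_minus; auto using cts_shift, cts_refl).
  eapply Rle_trans.
  - apply abs_RInt_le; [lra|now apply cts_ex_RInt].
  - apply RInt_le; [lra|now apply cts_ex_RInt, cts_abs|apply cts_ex_RInt, cts_mult;
    auto using cts_const; apply cts_mult; auto using cts_sin|].
    intros u Hu. pose proof (wrap_reflection beta beta_pos u d ltac:(lra) ltac:(lra)) as HR.
    change (Rabs (K u * (g (u + a) - g (a - u))) <= c * (K u * sin u)).
    assert (HKu : 0 <= K u) by (unfold K; lra).
    rewrite Rabs_mult, (Rabs_right (K u)) by lra.
    replace (c * (K u * sin u)) with (K u * (c * sin u)) by ring. apply Rmult_le_compat_l; [easy|].
    (* The points [a + u] and [a - u], exchanged by the reflection, have chord exactly [sin u]; no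
       constant is lost here. *)
    apply Rle_trans with (1 := HL _ _). apply Req_le. f_equal. unfold chord.
    replace ((u + a - (a - u)) / 2) with u by field. apply Rabs_right, Rle_ge, sin_ge_0; lra.
Qed.

(** Up to [PI / 6] the cosine is at least 1/2; beyond, the sine is at least 1/2 while
    [y <= PI / 2 <= 2]. *)
Lemma le_4_sin y : 0 <= y <= PI / 2 -> y <= 4 * sin y.
Proof.
  intros Hy. pose proof PI_RGT_0 as HP. destruct (Rle_dec y (PI / 6)) as [H|H].
  - destruct (Req_dec y 0) as [->|Hy0]; [rewrite sin_0; lra|].
    destruct (MVT_cor2 sin cos 0 y) as (c & E & Hc); [lra|intros; apply derivable_pt_lim_sin|].
    rewrite sin_0 in E. assert (1 / 2 <= cos c) by (rewrite <- cos_PI3; apply cos_decr_1; lra). nra.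
  - assert (1 / 2 <= sin y) by (rewrite <- sin_PI6; apply sin_incr_1; lra). pose proof PI_4. lra.
Qed.

Lemma le_chord u v : Rabs (u - v) <= PI -> Rabs (u - v) <= 8 * chord u v.
Proof.
  intros H. unfold chord. pose proof (le_4_sin (Rabs (u - v) / 2)) as HS.
  pose proof (Rabs_pos (u - v)). specialize (HS ltac:(lra)).
  enough (sin (Rabs (u - v) / 2) <= Rabs (sin ((u - v) / 2))) by lra.
  unfold Rabs at 1. destruct (Rcase_abs (u - v)).
  - replace (- (u - v) / 2) with (- ((u - v) / 2)) by field. rewrite sin_neg, <- Rabs_Ropp.
  apply Rle_abs.
  - apply Rle_abs.
Qed.

(** The density is Lipschitz in the base point, and the usual distance is at most 8 chords once the
    base points are lifted to distance at most [PI]. The constant is 2 PI (normalisation) times 4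
    [decay_const] ([wrap_lip]) times 2 (oscillation) times 8. *)
Lemma phi_smooth (g : R -> R) : bounded_lip dR g -> (forall t t', Rabs (g t - g t') <= 2) ->
  forall x x', Rabs (int1 (fun t => phi beta x t * g t) - int1 (fun t => phi beta x' t * g t))
    <= (128 * PI * decay_const beta) * chord x x'.
Proof.
  intros Hg HL x x'. pose proof PI_RGT_0 as HP. pose proof (decay_const_pos beta beta_pos) as HK.
  apply bounded_lip_cts in Hg.
  destruct (reduce_2PI (- PI) (x - x')) as [k Hk].
  replace (fun t => phi beta x' t * g t) with (fun t => phi beta (x' + 2 * PI * IZR k) t * g t)
    by (apply functional_extensionality; intros t; now rewrite phi_period).
  rewrite <- (chord_period k x x'). set (y := x' + 2 * PI * IZR k).
  assert (Hxy : Rabs (x - y) <= PI) by (apply Rabs_le; unfold y; lra).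
  apply le_chord in Hxy.
  assert (Hphi : forall z, cts (phi beta z)) by (intros z; apply ph_cts, phi_bounded_lip, beta_pos).
  (* All [phi beta z] have mass 1, so subtracting the constant [g 0] changes no difference of
     averages and turns the oscillation bound into a bound by 2 on the integrand. *)
  assert (E : forall z, int1 (fun t => phi beta z t * g t) = int1 (fun t => phi beta z t * (g t - g
    0)) + g 0).
  { intros z.
    replace (fun t => phi beta z t * g t) with (fun t => 1 * (phi beta z t * (g t - g 0)) + g 0 * phi
      beta z t)
      by (apply functional_extensionality; intros; ring).
    rewrite int1_lin; auto; [rewrite phi_int by easy; ring|]. apply cts_mult; auto.
    apply cts_minus; auto using cts_const. }
  rewrite (E x), (E y).
  assert (Hc : forall z, cts (fun t => phi beta z t * (g t - g 0))).
  { intros z. apply cts_mult; auto. apply cts_minus; auto using cts_const. }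
  match goal with |- Rabs ?e <= _ => replace e with (int1 (fun t => phi beta x t * (g t - g 0)) -
    int1 (fun t => phi beta y t * (g t - g 0))) by ring end.
  rewrite <- int1_minus by auto.
  rewrite <- (int1_const (128 * PI * decay_const beta * chord x y)).
  apply int1_abs_le; auto using cts_const, cts_minus.
  intros t _. rewrite <- Rmult_minus_distr_r, Rabs_mult, !phi_wrap by easy.
  rewrite <- Rmult_minus_distr_l, Rabs_mult, (Rabs_right (2 * PI)) by lra.
  pose proof (wrap_lip beta beta_pos (t - x) (t - y)) as HW.
  replace (t - x - (t - y)) with (- (x - y)) in HW by ring. rewrite Rabs_Ropp in HW.
  specialize (HL t 0).
  apply Rle_trans with ((2 * PI * (4 * decay_const beta * Rabs (x - y))) * 2).
  - apply Rmult_le_compat; auto using Rabs_pos.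
    + apply Rmult_le_pos; [lra|apply Rabs_pos].
    + apply Rmult_le_compat_l; lra.
  - replace (2 * PI * (4 * decay_const beta * Rabs (x - y)) * 2) with ((16 * PI * decay_const beta) *
    Rabs (x - y)) by ring.
    replace (128 * PI * decay_const beta * chord x y) with ((16 * PI * decay_const beta) * (8 * chord
      x y)) by ring.
    apply Rmult_le_compat_l; [|easy]. apply Rmult_le_pos; nra.
Qed.

End Circle.

Theorem theorem2 (q : nat) (beta : R) :
  (2 <= q)%nat -> 0 < beta -> INR q * lambda beta < 1 ->
  is_lim_seq (fun k : nat => exp_tv q beta k) 0.
Proof.
  intros Hq Hb Hl. pose proof (decay_const_pos beta Hb). pose proof PI_RGT_0.
  apply (exp_tv_lim q beta (lambda beta) (128 * PI * decay_const beta)); trivial.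
  - lia.
  - now apply phi_bounded_lip.
  - intros; now apply phi_pos.
  - intros; now apply phi_int.
  - intros g c Hg HL. now apply phi_contr.
  - intros g Hg HL. now apply phi_smooth.
  - apply Rmult_le_pos; nra.
  - now apply lambda_nonneg.
Qed.
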